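(* Let $\{\mu_t\}_{t\ge0}$ be a weakly continuous $\rhd$-convolution semigroup with $\mu_0=\delta_0$ and associated pair $(\gamma,\tau)$, and assume that the support of each $\mu_t$ is compact. The following are equivalent: (1) there exists $t_0>0$ such that $\mu_{t_0}$ is symmetric; (2) $\mu_t$ is symmetric for all $t>0$; (3) $\gamma=0$ and $\tau$ is symmetric.
   Context: A measure $\mu$ on $\mathbb{R}$ is symmetric if $\mu(B)=\mu(-B)$ for all Borel sets $B$. For a probability measure $\mu$, $G_\mu(z)=\int\frac{1}{z-x}d\mu(x)$ on $\mathbb{C}^+$ and $H_\mu=1/G_\mu$; $\mu\rhd\nu$ is the unique probability measure with $H_{\mu\rhd\nu}=H_\mu\circ H_\nu$. A weakly continuous $\rhd$-convolution semigroup is a weakly continuous family $\{\mu_t\}_{t\ge0}$ of probability measures with $\mu_s\rhd\mu_t=\mu_{s+t}$. For such a semigroup with $\mu_0=\delta_0$ there is a unique pair $(\gamma,\tau)$, $\gamma\in\mathbb{R}$, $\tau$ positive finite, such that with $A(z)=-\gamma+\int\frac{1+xz}{x-z}d\tau(x)$ the maps $H_t:=H_{\mu_t}$ solve $\frac{d}{dt}H_t(z)=A(H_t(z))$, $H_0(z)=z$, on $\mathbb{C}\setminus\mathbb{R}$ (the associated pair). *)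

(* Defs.v *)
From HB Require Import structures.
From mathcomp Require Import all_boot all_order all_algebra.
From mathcomp Require Import all_classical all_reals all_analysis.
From mathcomp Require Import complex.
Set Implicit Arguments. Unset Strict Implicit. Unset Printing Implicit Defensive.
Import Order.TTheory GRing.Theory Num.Theory.
Import numFieldNormedType.Exports.
Local Open Scope classical_set_scope.
Local Open Scope ring_scope.

Section MonotoneDefs.
Context (R : realType).
Local Notation C := (complex R).

Definition RtoC (x : R) : C := Complex x 0.

Definition cintegral (mu : {measure set R -> \bar R}) (f : R -> C) : C :=
  Complex (Rintegral mu setT (fun x => complex.Re (f x)))
          (Rintegral mu setT (fun x => complex.Im (f x))).

Definition cauchyG (mu : {measure set R -> \bar R}) (z : C) : C :=
  cintegral mu (fun x => (z - RtoC x)^-1).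

Definition cauchyH (mu : {measure set R -> \bar R}) (z : C) : C :=
  (cauchyG mu z)^-1.

Definition symmetric_measure (mu : {measure set R -> \bar R}) : Prop :=
  forall B : set R, measurable B -> mu B = mu [set - x | x in B].

Definition msupport (mu : {measure set R -> \bar R}) : set R :=
  [set x | forall U : set R, open U -> U x -> (0 < mu U)%E].

Definition weakly_continuous (mu : R -> probability R R) : Prop :=
  forall f : R -> R, continuous f -> (exists M : R, forall x, `|f x| <= M) ->
    {within `[0, +oo[%classic,
      continuous (fun t => Rintegral (mu t) setT f)}.

Definition is_monotone_conv (mu nu rho : {measure set R -> \bar R}) : Prop :=
  forall z : C, 0 < complex.Im z -> cauchyH rho z = cauchyH mu (cauchyH nu z).

Definition monotone_semigroup (mu : R -> probability R R) : Prop :=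
  forall s t : R, 0 <= s -> 0 <= t -> is_monotone_conv (mu s) (mu t) (mu (s + t)).

Definition generatorA (gamma : R) (tau : {finite_measure set R -> \bar R}) (z : C) : C :=
  - RtoC gamma + cintegral tau (fun x => (1 + RtoC x * z) / (RtoC x - z)).

Definition has_deriv_nonneg (f f' : R -> R) : Prop :=
  forall t : R, 0 <= t ->
    (fun h => (f (t + h) - f t) / h) @ within [set h | 0 <= t + h] (0 : R)^'
      --> f' t.

Definition associated_pair (mu : R -> probability R R) (gamma : R)
    (tau : {finite_measure set R -> \bar R}) : Prop :=
  forall z : C, complex.Im z != 0 ->
    cauchyH (mu 0) z = z /\
    has_deriv_nonneg (fun t => complex.Re (cauchyH (mu t) z))
                     (fun t => complex.Re (generatorA gamma tau (cauchyH (mu t) z))) /\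
    has_deriv_nonneg (fun t => complex.Im (cauchyH (mu t) z))
                     (fun t => complex.Im (generatorA gamma tau (cauchyH (mu t) z))).

End MonotoneDefs.

(* Main.v *)
(* Write [H_t] for the reciprocal Cauchy transform of [mu t]. A probability measure is symmetric
   if and only if its transform commutes with the reflection [z |-> - z^*] of the upper
   half-plane (Stieltjes inversion), and the same argument shows that [gamma = 0] with [tau]
   symmetric is equivalent to [A] commuting with the reflection.
   (3) => (2): conjugating [H_t] by the reflection gives a solution of the same Cauchy problem,
   so it is [H_t] by uniqueness.
   (1) => (3): [H_t0] is the compositional square of [H_(t0/2)] and also of its conjugate by the
   reflection. For compactly supported measures a compositional square root is unique, as a
   comparison of the leading terms at infinity shows; hence [H_(t0/2^n)] commutes with the
   reflection for all [n], and so does [A], the derivative of [H_t] at [t = 0]. *)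

Require Import Defs.
From HB Require Import structures.
From mathcomp Require Import all_boot all_order all_algebra.
From mathcomp Require Import all_classical all_reals all_analysis.
From mathcomp Require Import measurable_realfun complex ring lra.
Import Order.TTheory GRing.Theory Num.Theory.
Import numFieldNormedType.Exports.
Local Open Scope classical_set_scope.
Local Open Scope ring_scope.
Set Implicit Arguments.
Unset Strict Implicit.
Unset Printing Implicit Defensive.

(** * Complex integrals of bounded measurable functions *)

(** Conjugating by the reflection replaces a measure by its mirror image. On the probability space
    given by a compactly supported [mu] this amounts to replacing X, the identity truncated to an
    interval [-r, r] of full measure, by -X. Uniqueness of the square root thus becomes a statement
    about two bounded variables on one space. What the leading terms at infinity compare are
    moments; the passage from equal moments back to equal transforms on the whole upper half-plane
    avoids analytic continuation and rests on linear recursions whose solutions obey geometric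
    bounds. Stieltjes inversion is elementary as well: the Poisson kernel is the derivative of an
    arctangent in its centre, so it is integrated by differentiating under the integral sign. In the
    uniqueness for the differential equation the obstacle is that the Lipschitz bound on [A]
    degenerates at the real axis and at infinity; trajectories over a bounded time interval have to
    be confined first. *)

Section BoundedIntegrals.
Context {R : realType}.
Implicit Types (mu : {measure set R -> \bar R}) (f g : R -> R) (F G : R -> R[i]).
Local Notation C := R[i].
Local Notation Re := (@complex.Re R).
Local Notation Im := (@complex.Im R).

(** Resolvents are bounded off the real axis, which puts the integrands used below in this class. It
    gives integrability for a finite measure and, unlike integrability, is closed under products. *)
Definition bounded_meas f :=
  measurable_fun [set: R] f /\ exists M, forall x, `|f x| <= M.

Lemma bounded_meas_integrable mu f : (mu setT < +oo)%E -> bounded_meas f ->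
  mu.-integrable setT (EFin \o f).
Proof.
move=> fin [mf [M fM]]; apply: measurable_bounded_integrable => //.
exists M; split; first exact: num_real.
by move=> N MN x _; apply: le_trans (fM x) (ltW MN).
Qed.

Lemma bounded_meas_cst c : bounded_meas (fun=> c).
Proof. by split; [exact: measurable_cst | exists `|c|]. Qed.

Lemma bounded_measD f g : bounded_meas f -> bounded_meas g ->
  bounded_meas (fun x => f x + g x).
Proof.
move=> [mf [M fM]] [mg [N gN]]; split; first exact: measurable_funD.
by exists (M + N) => x; apply: le_trans (ler_normD _ _) (lerD _ _).
Qed.

Lemma bounded_measM f g : bounded_meas f -> bounded_meas g ->
  bounded_meas (fun x => f x * g x).
Proof.
move=> [mf [M fM]] [mg [N gN]]; split; first exact: measurable_funM.
by exists (M * N) => x; rewrite normrM ler_pM.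
Qed.

Lemma bounded_measN f : bounded_meas f -> bounded_meas (fun x => - f x).
Proof.
move=> bf; rewrite (_ : (fun x => - f x) = fun x => -1 * f x).
  by apply: bounded_measM => //; exact: bounded_meas_cst.
by apply/funext => x; rewrite mulN1r.
Qed.

Definition cbounded_meas F :=
  bounded_meas (fun x => Re (F x)) /\ bounded_meas (fun x => Im (F x)).

Lemma ReD (z w : C) : Re (z + w) = Re z + Re w. Proof. by case: z w => ? ? []. Qed.
Lemma ImD (z w : C) : Im (z + w) = Im z + Im w. Proof. by case: z w => ? ? []. Qed.
Lemma ReN (z : C) : Re (- z) = - Re z. Proof. by case: z. Qed.
Lemma ImN (z : C) : Im (- z) = - Im z. Proof. by case: z. Qed.
Lemma ReM (z w : C) : Re (z * w) = Re z * Re w - Im z * Im w.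
Proof. by case: z w => ? ? []. Qed.
Lemma ImM (z w : C) : Im (z * w) = Re z * Im w + Im z * Re w.
Proof. by case: z w => ? ? []. Qed.
Lemma Reconj (z : C) : Re (z^*)%C = Re z. Proof. by case: z. Qed.
Lemma Imconj (z : C) : Im (z^*)%C = - Im z. Proof. by case: z. Qed.
Lemma Re_inv (z : C) : Re z^-1 = Re z / (Re z ^+ 2 + Im z ^+ 2). Proof. by case: z. Qed.
Lemma Im_inv (z : C) : Im z^-1 = - (Im z / (Re z ^+ 2 + Im z ^+ 2)). Proof. by case: z. Qed.

Lemma complex_ext (z w : C) : Re z = Re w -> Im z = Im w -> z = w.
Proof. by case: z w => ? ? [? ?] /= -> ->. Qed.

Definition complex_parts := (ReD, ImD, ReN, ImN, ReM, ImM, Reconj, Imconj).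

Lemma Im_neq0 (z : C) : Im z != 0 -> z != 0.
Proof. by apply: contraNneq => ->. Qed.

Lemma cbounded_meas_cst c : cbounded_meas (fun=> c).
Proof. by split; exact: bounded_meas_cst. Qed.

Lemma cbounded_measD F G : cbounded_meas F -> cbounded_meas G ->
  cbounded_meas (fun x => F x + G x).
Proof.
move=> [F1 F2] [G1 G2]; split.
  by under eq_fun do rewrite ReD; exact: bounded_measD.
by under eq_fun do rewrite ImD; exact: bounded_measD.
Qed.

Lemma cbounded_measM F G : cbounded_meas F -> cbounded_meas G ->
  cbounded_meas (fun x => F x * G x).
Proof.
move=> [F1 F2] [G1 G2]; split.
  under eq_fun do rewrite ReM.
  by apply: bounded_measD; last apply: bounded_measN; exact: bounded_measM.
by under eq_fun do rewrite ImM; apply: bounded_measD; exact: bounded_measM.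
Qed.

Lemma cbounded_measN F : cbounded_meas F -> cbounded_meas (fun x => - F x).
Proof.
move=> [F1 F2]; split.
  by under eq_fun do rewrite ReN; exact: bounded_measN.
by under eq_fun do rewrite ImN; exact: bounded_measN.
Qed.

Lemma cbounded_measX F n : cbounded_meas F -> cbounded_meas (fun x => F x ^+ n).
Proof.
move=> bF; elim: n => [|n IH]; first exact: cbounded_meas_cst.
by under eq_fun do rewrite exprS; exact: cbounded_measM.
Qed.

Lemma cbounded_meas_real f : bounded_meas f -> cbounded_meas (fun x => RtoC (f x)).
Proof. by move=> bf; split => //=; exact: bounded_meas_cst. Qed.

Lemma measurable_inv_pos f : measurable_fun [set: R] f -> (forall x, 0 < f x) ->
  measurable_fun [set: R] (fun x => (f x)^-1).
Proof.
move=> mf fp; rewrite (_ : (fun x => _) = (fun x => expR (- ln (f x)))).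
  apply: measurableT_comp; first exact: measurable_expR.
  apply: measurableT_comp => //; exact: measurableT_comp.
by apply/funext => x; rewrite expRN lnK// posrE.
Qed.

(** With u = a - f x, both parts have denominator u^2 + b^2 and are bounded by 1/|b|, since |u b|
    and b^2 are at most u^2 + b^2. A general [f] serves the random variables of the square root
    argument. *)
Lemma cbounded_meas_resolvent f (z : C) : measurable_fun [set: R] f -> Im z != 0 ->
  cbounded_meas (fun x => (z - RtoC (f x))^-1).
Proof.
case: z => a b mf /= b0.
have den x : 0 < (a - f x) ^+ 2 + b ^+ 2.
  by rewrite ltr_wpDl ?sqr_ge0// exprn_even_gt0.
have mR : measurable_fun [set: R] (fun x => a - f x).
  by apply: measurable_funB => //; exact: measurable_cst.
have mD : measurable_fun [set: R] (fun x => ((a - f x) ^+ 2 + b ^+ 2)^-1).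
  apply: measurable_inv_pos den; apply: measurable_funD; last exact: measurable_cst.
  exact: measurable_funX.
split => /=.
- split; first by rewrite subr0; apply: measurable_funM.
  exists `|b|^-1 => x; rewrite subr0 normrM (gtr0_norm (x := _^-1)) ?invr_gt0//.
  rewrite ler_pdivrMr// ler_pdivlMl ?normr_gt0//.
  rewrite -(@real_normK _ (a - f x)) ?num_real// -(@real_normK _ b) ?num_real//.
  by have := sqr_ge0 (`|a - f x| - `|b|); nra.
- split.
    rewrite subr0; apply: measurableT_comp => //.
    by apply: measurable_funM => //; exact: measurable_cst.
  exists `|b|^-1 => x; rewrite subr0 normrN normrM (gtr0_norm (x := _^-1)) ?invr_gt0//.
  rewrite ler_pdivrMr// ler_pdivlMl ?normr_gt0//.
  by rewrite -normrM -expr2 ger0_norm ?sqr_ge0// lerDr sqr_ge0.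
Qed.

Lemma eq_cintegral mu F G : F =1 G -> cintegral mu F = cintegral mu G.
Proof. by move=> FG; congr cintegral; exact/funext. Qed.

Section Linearity.
Variable mu : {measure set R -> \bar R}.
Hypothesis fin : (mu setT < +oo)%E.

Lemma cintegralD F G : cbounded_meas F -> cbounded_meas G ->
  cintegral mu (fun x => F x + G x) = cintegral mu F + cintegral mu G.
Proof.
move=> [F1 F2] [G1 G2]; apply: complex_ext => /=.
  by under eq_Rintegral do rewrite ReD;
     rewrite RintegralD//; exact: bounded_meas_integrable.
by under eq_Rintegral do rewrite ImD;
   rewrite RintegralD//; exact: bounded_meas_integrable.
Qed.

Lemma cintegralZ c F : cbounded_meas F ->
  cintegral mu (fun x => c * F x) = c * cintegral mu F.
Proof.
move=> [F1 F2].
have Z k f : bounded_meas f -> mu.-integrable setT (EFin \o (fun x => k * f x)).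
  move=> bf; apply: bounded_meas_integrable => //.
  by apply: bounded_measM => //; exact: bounded_meas_cst.
apply: complex_ext; rewrite complex_parts /=.
- under eq_Rintegral do rewrite ReM.
  rewrite RintegralB ?RintegralZl //; do ?exact: Z; exact: bounded_meas_integrable.
- under eq_Rintegral do rewrite ImM.
  rewrite RintegralD ?RintegralZl //; do ?exact: Z; exact: bounded_meas_integrable.
Qed.

Lemma cintegralN F : cbounded_meas F ->
  cintegral mu (fun x => - F x) = - cintegral mu F.
Proof.
move=> bF; rewrite -mulN1r -cintegralZ//.
by apply: eq_cintegral => x; rewrite mulN1r.
Qed.

Lemma cintegralB F G : cbounded_meas F -> cbounded_meas G ->
  cintegral mu (fun x => F x - G x) = cintegral mu F - cintegral mu G.
Proof.
by move=> bF bG; rewrite cintegralD ?cintegralN//; exact: cbounded_measN.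
Qed.

Lemma cintegral_cst c : cintegral mu (fun=> c) = c * RtoC (fine (mu setT)).
Proof.
case: c => a b; rewrite /cintegral /= !Rintegral_cst//.
by apply: complex_ext; rewrite complex_parts /=; ring.
Qed.

Lemma cintegral_conj F : cbounded_meas F ->
  cintegral mu (fun x => (F x)^*%C) = ((cintegral mu F)^*)%C.
Proof.
move=> [F1 F2]; apply: complex_ext; rewrite complex_parts /=.
  by under eq_Rintegral do rewrite Reconj.
under eq_Rintegral do rewrite Imconj -mulN1r.
by rewrite RintegralZl ?mulN1r//; exact: bounded_meas_integrable.
Qed.

(** The factor 2 is the price of bounding real and imaginary parts separately; in the estimates
    below only rates of decay matter, not constants. *)
Lemma norm_cintegral_le F M : cbounded_meas F -> (forall x, `|F x| <= (M%:C)%C) ->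
  `|cintegral mu F| <= ((2 * M * fine (mu setT))%:C)%C.
Proof.
move=> [F1 F2] FM.
have bnd f : bounded_meas f -> (forall x, `|f x| <= M) ->
    `|\int[mu]_x f x| <= M * fine (mu setT).
  move=> bf fM; apply: (le_trans (le_normr_Rintegral _ _)) => //.
    exact: bounded_meas_integrable.
  rewrite -Rintegral_cst//; apply: le_Rintegral => //.
    apply: bounded_meas_integrable => //; case: bf => mf [N fN].
    by split; [exact: measurableT_comp | exists N => x; rewrite normr_id].
  exact/bounded_meas_integrable/bounded_meas_cst.
have ReF x : `|Re (F x)| <= M.
  by rewrite -lecR; apply: le_trans (FM x); exact: normc_ge_Re.
have ImF x : `|Im (F x)| <= M.
  rewrite -lecR; apply: le_trans (FM x).
  by rewrite normc_def lecR -sqrtr_sqr ler_wsqrtr// lerDr sqr_ge0.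
have {}ReF := bnd _ F1 ReF; have {}ImF := bnd _ F2 ImF.
have K0 : 0 <= M * fine (mu setT) by apply: le_trans ReF.
rewrite normc_def lecR -[leRHS]ger0_norm; last by rewrite -mulrA mulr_ge0.
rewrite -sqrtr_sqr ler_wsqrtr//= -mulrA.
move: (M * fine _) K0 ReF ImF => K K0; rewrite !ler_norml => /andP[a1 a2] /andP[b1 b2].
have := mulr_ge0 (_ : 0 <= K - \int[mu]_x Re (F x)) (_ : 0 <= K + \int[mu]_x Re (F x)).
have := mulr_ge0 (_ : 0 <= K - \int[mu]_x Im (F x)) (_ : 0 <= K + \int[mu]_x Im (F x)).
rewrite !subr_ge0 -!lerBlDl !sub0r => /(_ b2 b1) h1 /(_ a2 a1) h2.
by have := sqr_ge0 K; nra.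
Qed.

End Linearity.
End BoundedIntegrals.

(** * The Poisson kernel determines a finite measure *)

Section PoissonKernel.
Context {R : realType}.
Implicit Types (mu nu : {measure set R -> \bar R}) (f g : R -> R)
  (F : R -> R[i]).

Lemma bounded_cvg_Rintegral mu (f_ : nat -> R -> R) f (M : R) :
  (mu setT < +oo)%E -> (forall n, measurable_fun [set: R] (f_ n)) ->
  measurable_fun [set: R] f -> (forall n x, `|f_ n x| <= M) ->
  (forall x, f_ n x @[n --> \oo] --> f x) ->
  (\int[mu]_x f_ n x) @[n --> \oo] --> \int[mu]_x f x.
Proof.
move=> fin mf_ mf f_M f_f.
have M0 : 0 <= M by apply: le_trans (f_M 0%N 0).
have iM : mu.-integrable setT (EFin \o (fun=> M : R)).
  exact/bounded_meas_integrable/bounded_meas_cst.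
have [] := @dominated_convergence _ _ _ mu _ measurableT
  (fun n => EFin \o f_ n) (EFin \o f) (EFin \o (fun=> M : R)) => //.
- by move=> n; exact/measurable_EFinP.
- exact/measurable_EFinP.
- by apply: aeW => x _ /=; apply: cvg_EFin; [exact: nearW | exact: f_f].
- by apply: aeW => x n _; rewrite /= lee_fin.
move=> intf _ cvgf; apply: fine_cvg; rewrite fineK//.
exact: integrable_fin_num.
Qed.

Lemma measurable_atan : measurable_fun [set: R] (@atan R).
Proof. by apply: continuous_measurable_fun => x; exact: continuous_atan. Qed.

Lemma atan_bound (x : R) : `|atan x| <= pi / 2.
Proof.
rewrite ler_norml; apply/andP; split; apply/ltW; first exact: atan_gtNpi2.
exact: atan_ltpi2.
Qed.

Let bounded_atan (a y : R) : bounded_meas (fun x => atan ((a - x) / y)).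
Proof.
split; last by exists (pi / 2) => x; exact: atan_bound.
apply: (measurableT_comp measurable_atan).
apply: measurable_funM; last exact: measurable_cst.
by apply: measurable_funB => //; exact: measurable_cst.
Qed.

(** Differentiation under the integral sign: the Poisson kernel is the derivative of
    [atan ((a - x) / y)] in [a], and it never exceeds 1/y, which is integrable for a finite
    measure. *)
Lemma is_derive_atan_integral mu (a y : R) : (mu setT < +oo)%E -> 0 < y ->
  is_derive a 1 (fun a => \int[mu]_x atan ((a - x) / y))
    (\int[mu]_x (y / ((a - x) ^+ 2 + y ^+ 2))).
Proof.
move=> fin y0.
have den b x : 0 < (b - x) ^+ 2 + y ^+ 2 by rewrite ltr_wpDl ?sqr_ge0 ?exprn_gt0.
have der (b x : R) : is_derive b (1 : R) (fun b => atan ((b - x) / y))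
    (y / ((b - x) ^+ 2 + y ^+ 2)).
  have -> : y / ((b - x) ^+ 2 + y ^+ 2) = (1 + ((b - x) / y) ^+ 2)^-1 * y^-1.
    have := den b x; move: (b - x) => u den0.
    have -> : 1 + (u / y) ^+ 2 = (u ^+ 2 + y ^+ 2) / y ^+ 2.
      by rewrite expr_div_n mulrDl divff ?expf_neq0 ?gt_eqF// addrC.
    by rewrite invf_div (expr2 y) mulrAC mulfK ?gt_eqF.
  have -> : (fun b => atan ((b - x) / y)) = atan \o (y^-1 *: (id - cst x) : R -> R).
    by apply/funext => c /=; rewrite mulrC.
  have -> : (b - x) / y = (y^-1 *: (id - cst x) : R -> R) b by rewrite mulrC.
  apply: is_derive1_comp.
  by apply: is_derive_eq; rewrite subr0 /GRing.scale/= mulr1.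
have par b x : partial1of2 (fun b x => atan ((b - x) / y)) b x =
    y / ((b - x) ^+ 2 + y ^+ 2).
  by rewrite partial1of2E; apply: derive_val.
have int b : mu.-integrable setT (EFin \o (fun x => atan ((b - x) / y))).
  exact: bounded_meas_integrable.
have aI : `]a - 1, a + 1[%classic a by rewrite /= in_itv/=; lra.
have cv := @cvg_differentiation_under_integral R _ R mu (fun b x => atan ((b - x) / y))
  setT measurableT a (a - 1) (a + 1) aI (fun b _ => int b)
  (fun b x _ _ => @ex_derive _ _ _ _ _ _ _ (der b x)) (fun=> y^-1).
have {}cv := cv (fun=> ltW (eq_ind_r is_true y0 (invr_gt0 y)))
  (bounded_meas_integrable fin (bounded_meas_cst _)).
have {cv} : (h^-1 *: ((\int[mu]_x atan ((h + a - x) / y)) -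
    \int[mu]_x atan ((a - x) / y))) @[h --> 0^'] -->
    \int[mu]_x (y / ((a - x) ^+ 2 + y ^+ 2)).
  have <- : \int[mu]_x partial1of2 (fun b x => atan ((b - x) / y)) a x =
      \int[mu]_x (y / ((a - x) ^+ 2 + y ^+ 2)).
    by apply: eq_Rintegral => x _; rewrite par.
  apply: cv => b x _ _; rewrite par ger0_norm; last by rewrite divr_ge0// ltW.
  by rewrite ler_pdivrMr// ler_pdivlMl// -expr2 lerDr sqr_ge0.
move=> cv; apply: DeriveDef.
  apply/cvg_ex; exists (\int[mu]_x (y / ((a - x) ^+ 2 + y ^+ 2))).
  by under eq_fun do rewrite scaler1.
by rewrite -derive1E; apply: cvg_lim.
Qed.

Lemma cvg_atan_pinfty (u : R^nat) (k : R) : 0 < k ->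
  (\forall n \near \oo, k * n%:R <= u n) -> atan (u n) @[n --> \oo] --> pi / 2.
Proof.
move=> k0 ku; apply: cvg_comp; last exact: cvgy_atan.
apply/cvgryPge => A; near=> n.
apply: (@le_trans _ _ (k * n%:R)); last by near: n.
rewrite -ler_pdivrMl//; near: n; exact: nbhs_infty_ger.
Unshelve. all: by end_near. Qed.

Lemma cvg_atan_integral mu (y : R) : (mu setT < +oo)%E -> 0 < y ->
  (\int[mu]_x atan ((n%:R - x) / y)) @[n --> \oo] --> pi / 2 * fine (mu setT).
Proof.
move=> fin y0; rewrite -Rintegral_cst//.
apply: (@bounded_cvg_Rintegral _ _ _ (pi / 2)) => //.
- by move=> n; have [] := bounded_atan n%:R y.
- by move=> n x; exact: atan_bound.
move=> x; apply: (@cvg_atan_pinfty _ (2 * y)^-1); first by rewrite invr_gt0 mulr_gt0.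
near=> n; rewrite ler_pdivlMr//.
have -> : (2 * y)^-1 * n%:R * y = 2^-1 * n%:R by field; rewrite gt_eqF.
have : 2 * x <= n%:R by near: n; exact: nbhs_infty_ger.
lra.
Unshelve. all: by end_near. Qed.

(** The centre approaches b from the left at distance 1/(n+2), while the width 1/(n+2)^2 is much
    smaller. Hence x = b ends up on the right of the jump and an atom at b contributes nothing to
    the open half-line. Starting at n+2 keeps the width below 1, as [poisson_unique] requires. *)
Lemma cvg_atan_integral_cdf mu (b : R) : (mu setT < +oo)%E ->
  (\int[mu]_x atan ((b - n.+2%:R^-1 - x) / (n.+2%:R^-1) ^+ 2)) @[n --> \oo] -->
  pi * fine (mu `]-oo, b[%classic) - pi / 2 * fine (mu setT).
Proof.
move=> fin.
have mI : measurable_fun [set: R] (\1_(`]-oo, b[%classic) : R -> R).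
  exact: measurable_indic.
have bI : bounded_meas (\1_(`]-oo, b[%classic) : R -> R).
  by split => //; exists 1 => x; rewrite indicE; case: (_ \in _); rewrite ?normr1 ?normr0.
have iI := bounded_meas_integrable fin bI.
have -> : pi * fine (mu `]-oo, b[%classic) - pi / 2 * fine (mu setT) =
    \int[mu]_x (pi * \1_(`]-oo, b[%classic) x - pi / 2).
  rewrite RintegralB//; last 2 first.
  - apply: bounded_meas_integrable => //.
    by apply: bounded_measM => //; exact: bounded_meas_cst.
  - exact/bounded_meas_integrable/bounded_meas_cst.
  by rewrite RintegralZl// Rintegral_cst// /Rintegral integral_indic// setIT.
apply: (@bounded_cvg_Rintegral _ _ _ (pi / 2)) => //.
- by move=> n; have [] := bounded_atan (b - n.+2%:R^-1) ((n.+2%:R^-1) ^+ 2).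
- apply: measurable_funB; last exact: measurable_cst.
  by apply: measurable_funM => //; exact: measurable_cst.
- by move=> n x; exact: atan_bound.
move=> x.
have E n : (b - n.+2%:R^-1 - x) / (n.+2%:R^-1) ^+ 2 = n.+2%:R ^+ 2 * (b - x) - n.+2%:R :> R.
  by field; rewrite -natr1; apply/eqP; have := ler0n R n; lra.
under eq_fun do rewrite E.
have [xb|xb] := ltP x b.
  rewrite indicE mem_set/= ?in_itv//= mulr1.
  rewrite (_ : pi - pi / 2 = pi / 2); last by lra.
  apply: (@cvg_atan_pinfty _ 1) => //.
  near=> n; rewrite mul1r.
  have : 2 / (b - x) <= n%:R by near: n; exact: nbhs_infty_ger.
  rewrite ler_pdivrMr ?subr_gt0// -[n.+2%:R]natr1 -[n.+1%:R]natr1.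
  have := ler0n R n; nra.
rewrite indicE memNset/= ?in_itv/= ?mulr0 ?sub0r; last by apply/negP; rewrite -leNgt.
under eq_fun do rewrite -[_ - _]opprK atanN.
apply: cvgN; apply: (@cvg_atan_pinfty _ 1) => //.
near=> n; rewrite mul1r -[n.+2%:R]natr1 -[n.+1%:R]natr1.
have := ler0n R n; nra.
Unshelve. all: by end_near. Qed.

(** Equal Poisson integrals make the two arctangent integrals differ by a constant in [a]; the
    constant is 0, as seen for [a] tending to infinity, because the total masses agree. Shrinking y
    then recovers the masses of open half-lines, a pi-system generating the Borel sets. *)
Lemma poisson_unique mu nu : (mu setT < +oo)%E -> mu setT = nu setT ->
  (forall a y, 0 < y < 1 -> \int[mu]_x (y / ((a - x) ^+ 2 + y ^+ 2)) =
                            \int[nu]_x (y / ((a - x) ^+ 2 + y ^+ 2))) ->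
  forall A, measurable A -> mu A = nu A.
Proof.
move=> fin T12 P12; have fin' : (nu setT < +oo)%E by rewrite -T12.
have atan12 a y : 0 < y < 1 ->
    \int[mu]_x atan ((a - x) / y) = \int[nu]_x atan ((a - x) / y).
  move=> y01; have /andP[y0 y1] := y01.
  pose D a := \int[mu]_x atan ((a - x) / y) - \int[nu]_x atan ((a - x) / y).
  have Dcst b : D b = D a.
    apply: is_derive_0_is_cst => c.
    have d1 := is_derive_atan_integral c fin y0.
    have d2 := is_derive_atan_integral c fin' y0.
    by have := is_deriveB d1 d2; rewrite P12// subrr.
  apply/eqP; rewrite -subr_eq0 -/(D a); apply/eqP.
  have : D n%:R @[n --> \oo] --> (0 : R).
    rewrite -(subrr (pi / 2 * fine (mu setT))) {2}T12.
    by apply: cvgB; exact: cvg_atan_integral.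
  under eq_fun do rewrite Dcst.
  by move=> /cvg_lim <- //; rewrite lim_cst.
have cdf12 b : mu `]-oo, b[%classic = nu `]-oo, b[%classic.
  have l1 := cvg_atan_integral_cdf (b := b) fin.
  have l2 := cvg_atan_integral_cdf (b := b) fin'.
  have E : (fun n => \int[mu]_x atan ((b - n.+2%:R^-1 - x) / n.+2%:R^-1 ^+ 2)) =
           (fun n => \int[nu]_x atan ((b - n.+2%:R^-1 - x) / n.+2%:R^-1 ^+ 2)).
    apply/funext => n; apply: atan12.
    rewrite exprn_gt0 ?invr_gt0 ?ltr0n//= expr_lt1 ?invr_ge0 ?ler0n//.
    by rewrite invf_lt1 ?ltr0n// ltr1n.
  rewrite E in l1.
  have e : fine (mu `]-oo, b[%classic) = fine (nu `]-oo, b[%classic).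
    apply: (mulfI (lt0r_neq0 (pi_gt0 R))); apply: (addIr (- (pi / 2 * fine (mu setT)))).
    by rewrite {2}T12; exact: (cvg_unique (@Rhausdorff R) l1 l2).
  have finI (m : {measure set R -> \bar R}) : (m setT < +oo)%E ->
      m `]-oo, b[%classic \is a fin_num.
    move=> finm; rewrite ge0_fin_numE//; apply: le_lt_trans finm.
    by apply: le_measure; rewrite ?inE.
  by rewrite -[LHS]fineK ?finI// e fineK ?finI.
pose g n : set R := `]-oo, n%:R[%classic.
apply: (measure_unique (@RGenInftyO.G R) g) => //.
- exact: RGenInftyO.measurableE.
- move=> _ _ [x ->] [y ->]; exists (Num.min x y).
  by apply/seteqP; split => z /=; rewrite !in_itv/= lt_min => /andP.
- by move=> n; exists n%:R.
- apply/seteqP; split => // x _; exists (Num.truncn `|x|).+1 => //.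
  rewrite /g/= in_itv/=; apply: le_lt_trans (ler_norm x) _.
  by have := truncn_itv (normr_ge0 x) => /andP[].
- by move=> _ [x ->].
- move=> n; apply: le_lt_trans fin; apply: le_measure => //; rewrite inE//.
  exact: measurable_itv.
Qed.

(** * Reflection of a measure in the origin *)

Section Reflection.
Variable mu : {measure set R -> \bar R}.
Hypothesis fin : (mu setT < +oo)%E.

Let measurable_opp : measurable_fun [set: R] (@GRing.opp R).
Proof. exact: (measurable_funN (@measurable_id _ _ _)). Qed.

Lemma image_oppr (B : set R) : [set - x | x in B] = (@GRing.opp R) @^-1` B.
Proof.
apply/seteqP; split => [_ [x Bx <-]|x Bx] /=; first by rewrite opprK.
by exists (- x) => //; rewrite opprK.
Qed.

Lemma reflected_measure : exists nu : {measure set R -> \bar R},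
  (forall A, nu A = mu (@GRing.opp R @^-1` A)) /\
  forall f, bounded_meas f -> \int[mu]_x f (- x) = \int[nu]_x f x.
Proof.
have [nu nuE] : exists nu : {measure set R -> \bar R},
    nu = pushforward mu (@GRing.opp R) :> (set R -> \bar R).
  by unshelve eexists; first refine (pushforward mu (@GRing.opp R)).
exists nu; split => [A|f bf]; first by rewrite nuE.
have [mf [M fM]] := bf; rewrite /Rintegral; congr fine.
transitivity (\int[pushforward mu (@GRing.opp R)]_x (f x)%:E)%E.
  have mf' : measurable_fun [set: R] (EFin \o f) by exact/measurable_EFinP.
  apply: esym; apply: (integral_pushforward measurable_opp mf') => //.
  apply: bounded_meas_integrable => //; split; last by exists M => x; exact: fM.
  exact: measurableT_comp.
by apply: eq_measure_integral => A _ _; rewrite nuE.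
Qed.

Lemma symmetric_Rintegral f : symmetric_measure mu -> bounded_meas f ->
  \int[mu]_x f (- x) = \int[mu]_x f x.
Proof.
move=> smu bf; have [nu [nuE ->//]] := reflected_measure; congr fine.
by apply: eq_measure_integral => A mA _; rewrite nuE -image_oppr -smu.
Qed.

Lemma symmetric_cintegral F : symmetric_measure mu -> cbounded_meas F ->
  cintegral mu (fun x => F (- x)) = cintegral mu F.
Proof.
move=> smu [F1 F2]; apply: complex_ext => /=.
  exact: (symmetric_Rintegral smu F1).
exact: (symmetric_Rintegral smu F2).
Qed.

(** The Poisson integral at [a] of the mirror image of [mu] is that of [mu] at [- a], so
    [poisson_unique] applies to [mu] and its mirror image. *)
Lemma symmetric_of_poisson :
  (forall a y, 0 < y < 1 -> \int[mu]_x (y / ((- a - x) ^+ 2 + y ^+ 2)) =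
                            \int[mu]_x (y / ((a - x) ^+ 2 + y ^+ 2))) ->
  symmetric_measure mu.
Proof.
move=> P12 B mB; have [nu [nuE int_nu]] := reflected_measure.
rewrite image_oppr -nuE; apply: (poisson_unique fin) => [|a y y01|//]; first by rewrite nuE.
have /andP[y0 _] := y01; rewrite -int_nu.
  rewrite -P12//; apply: eq_Rintegral => x _.
  by rewrite -opprD sqrrN opprK.
(* The kernel is the imaginary part of the resolvent at a - i y, a point of the lower half-plane so
   that the sign comes out positive. *)
have [|_ bIm] := @cbounded_meas_resolvent R id (Complex a (- y)) (@measurable_id _ _ _).
  by rewrite /= oppr_eq0 gt_eqF.
suff -> : (fun x => y / ((a - x) ^+ 2 + y ^+ 2)) =
    (fun x => complex.Im (Complex a (- y) - RtoC x)^-1) by [].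
by apply/funext => x /=; rewrite subr0 mulNr opprK sqrrN.
Qed.
End Reflection.
End PoissonKernel.

(** * Symmetry of a measure and of its transforms *)

Section ReflectionSymmetry.
Context {R : realType}.
Local Notation C := R[i].
Local Notation Re := (@complex.Re R).
Local Notation Im := (@complex.Im R).
Implicit Types (z w : C) (F : R -> C) (mu tau : {measure set R -> \bar R}).

(* Equivariance under [z |-> - z^*], the reflection of the upper half-plane in the imaginary axis *)
Definition reflection_equivariant (f : C -> C) :=
  forall z, 0 < Im z -> f (- (z^*)%C) = - ((f z)^*)%C.

Lemma RtoC_conj (x : R) : ((RtoC x)^*)%C = RtoC x.
Proof. by rewrite /RtoC /= oppr0. Qed.

Lemma conjcD z w : conjc (z + w) = conjc z + conjc w. Proof. exact: rmorphD. Qed.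
Lemma conjcN z : conjc (- z) = - conjc z. Proof. exact: rmorphN. Qed.
Lemma conjcM z w : conjc (z * w) = conjc z * conjc w. Proof. exact: rmorphM. Qed.
Definition conjcE := (conjcD, conjcN, conjcM, @conjc_inv R, @conjc1 R, RtoC_conj).

Lemma RtoCN (x : R) : RtoC (- x) = - RtoC x.
Proof. by apply: complex_ext; rewrite complex_parts //= oppr0. Qed.

Lemma sub_RtoC_neq0 z (x : R) : Im z != 0 -> z - RtoC x != 0.
Proof. by move=> z0; apply: Im_neq0; rewrite complex_parts /= subr0. Qed.

Lemma resolvent_cbounded z : Im z != 0 -> cbounded_meas (fun x => (z - RtoC x)^-1).
Proof. exact: (@cbounded_meas_resolvent R id). Qed.

Lemma Im_reflection z : Im (- (z^*)%C) = Im z.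
Proof. by rewrite !complex_parts opprK. Qed.

Lemma cauchyG_reflection mu z : (mu setT < +oo)%E -> symmetric_measure mu ->
  Im z != 0 -> cauchyG mu (- (z^*)%C) = - ((cauchyG mu z)^*)%C.
Proof.
move=> fin smu z0; rewrite /cauchyG.
have rb := resolvent_cbounded z0.
have rb' : cbounded_meas (fun x => (- (z^*)%C - RtoC x)^-1).
  by apply: resolvent_cbounded; rewrite Im_reflection.
rewrite -(symmetric_cintegral fin smu rb') -cintegral_conj// -cintegralN//.
  apply: eq_cintegral => x; rewrite RtoCN !conjcE.
  by rewrite -invrN; congr (_^-1); ring.
case: rb => rRe rIm; split.
  by under eq_fun do rewrite Reconj.
by under eq_fun do rewrite Imconj; exact: bounded_measN.
Qed.

(** The imaginary part of the Cauchy transform at a + i y is minus a Poisson integral, and the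
    reflection sends a + i y to - a + i y. Only the strip Im z < 1 is asked for, so that the
    application to [tau] can stay away from the point i. *)
Lemma symmetric_of_cauchyG mu : (mu setT < +oo)%E ->
  (forall z, 0 < Im z < 1 -> cauchyG mu (- (z^*)%C) = - ((cauchyG mu z)^*)%C) ->
  symmetric_measure mu.
Proof.
move=> fin Gsym; apply: symmetric_of_poisson => // a y y01.
have := congr1 Im (Gsym (Complex a y) y01); rewrite /cauchyG.
have y0 : y != 0 by case/andP: y01 => /gt_eqF ->.
have ImG b : Im (cintegral mu (fun x => (Complex b y - RtoC x)^-1)) =
    - \int[mu]_x (y / ((b - x) ^+ 2 + y ^+ 2)).
  have [_ bI] := @resolvent_cbounded (Complex b y) y0.
  rewrite -mulN1r -RintegralZl//=.
    by apply: eq_Rintegral => x _; rewrite subr0 mulN1r.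
  have iI := bounded_meas_integrable fin (bounded_measN bI).
  suff -> : (fun x => y / ((b - x) ^+ 2 + y ^+ 2)) =
      (fun x => - Im (Complex b y - RtoC x)^-1) by [].
  by apply/funext => x /=; rewrite subr0 opprK.
rewrite (_ : - ((Complex a y)^*)%C = Complex (- a) y); last first.
  by apply: complex_ext; rewrite !complex_parts//= opprK.
by rewrite Im_reflection !ImG => /oppr_inj.
Qed.

(** The integrand is negative at every point; were its integral zero, it would vanish almost
    everywhere and the whole line would be a null set. The strict sign keeps the transforms
    invertible and sends their reciprocals into the upper half-plane. *)
Lemma Im_resolvent_integral_lt0 mu (X : R -> R) z : mu setT = 1%E ->
  measurable_fun [set: R] X -> 0 < Im z ->
  Im (cintegral mu (fun x => (z - RtoC (X x))^-1)) < 0.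
Proof.
move=> mu1 mX z0; have fin : (mu setT < +oo)%E by rewrite mu1 ltry.
have z0' : Im z != 0 by rewrite gt_eqF.
have [_ bI] := cbounded_meas_resolvent mX z0'.
have neg x : Im (z - RtoC (X x))^-1 < 0.
  rewrite Im_inv oppr_lt0 !complex_parts /= subr0 divr_gt0//.
  by rewrite ltr_wpDl ?sqr_ge0// exprn_gt0.
have iI := bounded_meas_integrable fin bI.
have iN := bounded_meas_integrable fin (bounded_measN bI).
rewrite /= -oppr_gt0 -mulN1r -RintegralZl// lt_neqAle; apply/andP; split; last first.
  by apply: Rintegral_ge0 => x _; rewrite mulN1r oppr_ge0 ltW.
apply/negP => /eqP e.
have : (\int[mu]_x `|(- Im (z - RtoC (X x))^-1)%:E| = 0)%E.
  under eq_integral do rewrite gee0_abs ?lee_fin ?oppr_ge0 ?ltW//.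
  rewrite -[LHS]fineK; last exact: integrable_fin_num.
  congr (_%:E); rewrite e; apply: eq_Rintegral => x _.
  by rewrite mulN1r.
have mN : measurable_fun [set: R] (fun x => (- Im (z - RtoC (X x))^-1)%:E).
  by apply/measurable_EFinP; have [] := bounded_measN bI.
move=> /(ae_eq_integral_abs mu measurableT mN) [N [mN' N0 sub]].
suff : (mu setT <= mu N)%E by rewrite mu1 N0 lee_fin ler10.
apply: le_measure; rewrite ?inE// => x _; apply: sub => /= /(_ Logic.I) [].
by apply/eqP; rewrite oppr_eq0 lt_eqF.
Qed.

Lemma Im_inv_gt0 z : Im z < 0 -> 0 < Im z^-1.
Proof.
move=> z0; rewrite Im_inv oppr_gt0 pmulr_llt0// invr_gt0.
by rewrite ltr_wpDl ?sqr_ge0// exprn_even_gt0//= lt_eqF.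
Qed.

Lemma cauchyH_Im_gt0 mu z : mu setT = 1%E -> 0 < Im z -> 0 < Im (cauchyH mu z).
Proof.
move=> mu1 z0; apply: Im_inv_gt0.
exact: (Im_resolvent_integral_lt0 mu1 (@measurable_id _ _ _)).
Qed.

Lemma cauchyH_equivariant mu : (mu setT < +oo)%E -> symmetric_measure mu ->
  reflection_equivariant (cauchyH mu).
Proof.
move=> fin smu z z0; rewrite /cauchyH cauchyG_reflection ?gt_eqF//.
by rewrite invrN conjc_inv.
Qed.

Lemma symmetric_of_cauchyH mu : (mu setT < +oo)%E ->
  reflection_equivariant (cauchyH mu) -> symmetric_measure mu.
Proof.
move=> fin Hsym; apply: symmetric_of_cauchyG => // z /andP[z0 _].
by have := Hsym z z0; rewrite /cauchyH conjc_inv -invrN => /invr_inj.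
Qed.

(** This form shows that the kernel is bounded in x although its numerator grows, and it expresses
    [A] through the Cauchy transform of [tau]. *)
Lemma generator_kernelE z (x : R) : Im z != 0 ->
  (1 + RtoC x * z) / (RtoC x - z) = z - (1 + z ^+ 2) * (z - RtoC x)^-1.
Proof.
move=> z0; have zx := sub_RtoC_neq0 x z0.
have xz : RtoC x - z != 0 by rewrite -opprB oppr_eq0.
by field; rewrite zx xz.
Qed.

Lemma generator_kernel_cbounded z : Im z != 0 ->
  cbounded_meas (fun x => (1 + RtoC x * z) / (RtoC x - z)).
Proof.
move=> z0; under eq_fun do rewrite generator_kernelE//.
apply: cbounded_measD; first exact: cbounded_meas_cst.
apply/cbounded_measN/cbounded_measM; first exact: cbounded_meas_cst.
exact: resolvent_cbounded.
Qed.

(** * Reflection symmetry of the generator *)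

Section Generator.
Variables (gamma : R) (tau : {finite_measure set R -> \bar R}).

Lemma finite_measure_lty : (tau setT < +oo)%E.
Proof. by rewrite -ge0_fin_numE// fin_num_measure. Qed.
Local Notation fin := finite_measure_lty.

Lemma generatorA_equivariant : gamma = 0 -> symmetric_measure tau ->
  reflection_equivariant (generatorA gamma tau).
Proof.
move=> -> smu z z0; have {}z0 : Im z != 0 by rewrite gt_eqF.
have z0' : Im (- (z^*)%C) != 0 by rewrite Im_reflection.
rewrite /generatorA (_ : RtoC 0 = 0)// !oppr0 !add0r.
rewrite -(symmetric_cintegral fin smu (generator_kernel_cbounded z0')).
rewrite -(cintegral_conj fin (generator_kernel_cbounded z0)) -(cintegralN fin).
  apply: eq_cintegral => x; rewrite RtoCN !conjcE mulrNN -[RHS]mulrN -invrN.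
  by congr (_ / _); ring.
case: (generator_kernel_cbounded z0) => rRe rIm; split.
  by under eq_fun do rewrite Reconj.
by under eq_fun do rewrite Imconj; exact: bounded_measN.
Qed.

Lemma generatorAE z : Im z != 0 -> generatorA gamma tau z =
  - RtoC gamma + z * RtoC (fine (tau setT)) - (1 + z ^+ 2) * cauchyG tau z.
Proof.
move=> z0; rewrite /generatorA (eq_cintegral _ (fun x => generator_kernelE x z0)).
have rb := resolvent_cbounded z0.
rewrite cintegralB ?cintegral_cst ?cintegralZ ?addrA//; try exact: fin.
  exact: cbounded_meas_cst.
by apply: cbounded_measM => //; exact: cbounded_meas_cst.
Qed.

(** At the fixed point i of the reflection the term with 1 + z^2 drops out, and the real part of
    A(i) is - [gamma]; equivariance forces it to vanish. Elsewhere in the strip, division by 1 + z^2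
    turns equivariance of [A] into that of the Cauchy transform of [tau]. *)
Lemma equivariant_generatorA : reflection_equivariant (generatorA gamma tau) ->
  gamma = 0 /\ symmetric_measure tau.
Proof.
move=> Asym.
have g0 : gamma = 0.
  have := Asym (Complex 0 1) ltr01.
  have -> : - ((Complex 0 1)^*)%C = Complex 0 1 :> C.
    by apply: complex_ext; rewrite !complex_parts//= ?oppr0 ?opprK.
  have i2 : 1 + (Complex 0 1) ^+ 2 = 0 :> C by rewrite sqr_i subrr.
  rewrite !generatorAE ?oner_eq0// i2 mul0r subr0 => /(congr1 Re).
  rewrite !complex_parts /=; lra.
split=> //; apply: symmetric_of_cauchyG; first exact: fin.
move=> z /andP[z0 z1].
have z0' : Im z != 0 by rewrite gt_eqF.
have := Asym z z0; rewrite !generatorAE ?Im_reflection// g0 (_ : RtoC 0 = 0)// oppr0 !add0r.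
have nz : 1 + (z^*)%C ^+ 2 != 0.
  apply/eqP => e; have := congr1 Re e; have := congr1 Im e.
  rewrite !expr2 !complex_parts/=; nra.
rewrite !expr2 mulrNN !conjcE -!expr2.
move=> e; apply: (mulfI nz); move: e.
by rewrite mulNr opprB addrC => /addIr/(congr1 -%R); rewrite opprK mulrN.
Qed.
End Generator.
End ReflectionSymmetry.

(** * Uniqueness for the generating differential equation *)

Section OdeUniqueness.
Context {R : realType}.
Local Notation C := R[i].
Local Notation Re := (@complex.Re R).
Local Notation Im := (@complex.Im R).

(** At time 0 the given derivative is one-sided. Continuing the function by its tangent line to
    negative times makes it two-sided, so that the mean value and extreme value theorems apply on
    [0, T]. *)
Lemma has_deriv_nonneg_extend (f f' : R -> R) : has_deriv_nonneg f f' ->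
  exists g : R -> R, (forall t, 0 <= t -> g t = f t) /\
            (forall t : R, 0 <= t -> is_derive t (1 : R) g (f' t)).
Proof.
move=> df; pose g (t : R) : R := if 0 <= t then f t else f 0 + t * f' 0.
have gE t : 0 <= t -> g t = f t by rewrite /g => ->.
exists g; split=> // t t0.
suff cv : (h^-1 *: (g (h *: (1 : R) + t) - g t)) @[h --> (0 : R)^'] --> f' t.
  apply: DeriveDef; first by apply/cvg_ex; exists (f' t).
  exact: cvg_lim.
have /cvgrPdist_lt {}df := df t t0; apply/cvgrPdist_lt => e e0.
have := df e e0; rewrite near_withinE => {}df.
have tpos : \forall h \near (0 : R)^', t != 0 -> 0 < t + h.
  have [->|tn0] := eqVneq t 0; first exact: nearW.
  apply: nbhs_dnbhs; near=> h => _; rewrite -[ltLHS](subrr t) ltrD2l; near: h.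
  by apply: lt_nbhsr; rewrite oppr_lt0 lt_neqAle eq_sym tn0.
near=> h.
have h0 : h != 0 by near: h; exact: nbhs_dnbhs_neq.
have hE : h *: (1 : R) + t = t + h by rewrite /GRing.scale/= mulr1 addrC.
rewrite hE (gE t t0); have [th|th] := leP 0 (t + h).
  by rewrite gE// /GRing.scale/= mulrC; move: th; near: h.
(* Near a positive t the argument stays positive, so a negative t + h leaves only t = 0, where the
   quotient along the tangent line is exact. *)
rewrite /g leNgt th/=; suff t00 : t = 0.
  rewrite t00 add0r (addrC (f 0)) addrK /GRing.scale/= mulrA mulVf// mul1r subrr normr0//.
apply/eqP; apply: contraTT isT => tn0.
suff : 0 < t + h by move=> /lt_trans/(_ th); rewrite ltxx.
by move: tn0; near: h.
Unshelve. all: by end_near. Qed.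

(** The product of D with the integrating factor exp(- K t) is nonincreasing. *)
Lemma gronwall_zero (D D' : R -> R) (K T : R) : 0 <= T ->
  (forall t : R, 0 <= t <= T -> is_derive t (1 : R) D (D' t)) ->
  (forall t, 0 <= t <= T -> D' t <= K * D t) -> D 0 = 0 -> D T <= 0.
Proof.
move=> T0 dD D'K D0.
pose E (t : R) : R := D t * expR (- K * t).
have dE (t : R) : 0 <= t <= T ->
    is_derive t (1 : R) E ((D' t - K * D t) * expR (- K * t)).
  move=> tT; have dDt := dD t tT.
  have de : is_derive t (1 : R) (fun t : R => expR (- K * t)) (expR (- K * t) * - K).
    have -> : (fun t => expR (- K * t)) = expR \o (- K *: id : R -> R) by [].
    apply: is_derive1_comp.
    by apply: is_derive_eq; rewrite /GRing.scale/= mulr1.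
  have -> : E = D * (fun t : R => expR (- K * t)) by [].
  apply: is_derive_eq; rewrite /GRing.scale/=; ring.
have : E T <= E 0.
  apply: (@ler0_derive1_le_cc R E 0 T) => //.
  - move=> x; rewrite in_itv/= => /andP[/ltW x0 /ltW xT].
    by apply: ex_derive; apply: dE; rewrite x0.
  - move=> x; rewrite in_itv/= => /andP[/ltW x0 /ltW xT].
    have xx : 0 <= x <= T by rewrite x0.
    have := dE x xx => dEx; rewrite derive1E derive_val.
    by rewrite mulr_le0_ge0 ?expR_ge0// subr_le0 D'K.
  - apply: derivable_within_continuous => x; rewrite in_itv/= => xx.
    by apply: ex_derive; exact: dE.
  - by rewrite in_itv/= T0 lexx.
  - by rewrite in_itv/= T0 lexx.
by rewrite /E D0 mul0r pmulr_lle0 ?expR_gt0.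
Qed.

(** The left side is half the derivative of the squared distance of two solutions, the form in which
    Gronwall uses it. The kernels at z and w differ by (z - w)(1 + x^2) / ((x - z)(x - w)), so it
    suffices to bound (1 + x^2) / |x - v|^2 uniformly in x for v = z and v = w. *)
Lemma generator_lipschitz (gamma : R) (tau : {finite_measure set R -> \bar R})
    (B c : R) : 0 < c -> exists K, forall z w : C,
  c <= Im z -> c <= Im w -> Re z ^+ 2 <= B -> Re w ^+ 2 <= B ->
  Re (((z - w)^*)%C * (generatorA gamma tau z - generatorA gamma tau w)) <=
  K * (Re (z - w) ^+ 2 + Im (z - w) ^+ 2).
Proof.
(* From x^2 <= 2 (x - Re v)^2 + 2 (Re v)^2: the first term is at most 2 |x - v|^2, and 1 + 2 B is
   absorbed by (Im v)^2 >= c^2. *)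
move=> c0; pose K := 2 + (1 + 2 * B) / c ^+ 2.
exists (K * fine (tau setT)) => z w zc wc zB wB.
have fin := finite_measure_lty tau.
have z0 : Im z != 0 by rewrite gt_eqF// (lt_le_trans c0).
have w0 : Im w != 0 by rewrite gt_eqF// (lt_le_trans c0).
have bz := generator_kernel_cbounded z0.
have bw := generator_kernel_cbounded w0.
have bd : cbounded_meas (fun x => ((z - w)^*)%C *
    ((1 + RtoC x * z) / (RtoC x - z) - (1 + RtoC x * w) / (RtoC x - w))).
  apply: cbounded_measM; first exact: cbounded_meas_cst.
  by apply: cbounded_measD => //; exact: cbounded_measN.
rewrite /generatorA opprD addrACA subrr add0r -cintegralB// -cintegralZ//; last first.
  by apply: cbounded_measD => //; exact: cbounded_measN.
set d2 := Re (z - w) ^+ 2 + Im (z - w) ^+ 2.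
rewrite mulrAC -Rintegral_cst//; apply: le_Rintegral => //.
- by apply: bounded_meas_integrable => //; case: bd.
- exact/bounded_meas_integrable/bounded_meas_cst.
move=> x _.
have den v : c <= Im v -> Re v ^+ 2 <= B ->
    (1 + x ^+ 2) * (Re (RtoC x - v)^-1 ^+ 2 + Im (RtoC x - v)^-1 ^+ 2) <= K.
  move=> vc vB.
  have -> : Re (RtoC x - v)^-1 ^+ 2 + Im (RtoC x - v)^-1 ^+ 2 =
      ((x - Re v) ^+ 2 + Im v ^+ 2)^-1.
    rewrite Re_inv Im_inv !complex_parts /= sub0r !sqrrN !exprMn !sqrrN -mulrDl.
    have : 0 < (x - Re v) ^+ 2 + Im v ^+ 2.
      by rewrite ltr_wpDl ?sqr_ge0// exprn_gt0// (lt_le_trans c0).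
    by move: (_ ^+ 2 + _ ^+ 2) => q q0; field; rewrite gt_eqF.
  have v2 : c ^+ 2 <= Im v ^+ 2 by rewrite lerXn2r ?nnegrE// ltW// (lt_le_trans c0).
  rewrite ler_pdivrMr; last by rewrite ltr_wpDl ?sqr_ge0// exprn_gt0// (lt_le_trans c0).
  have B0 : 0 <= B by apply: le_trans vB; exact: sqr_ge0.
  have k0 : 0 <= (1 + 2 * B) / c ^+ 2 by rewrite divr_ge0 ?sqr_ge0//; lra.
  have k1 : (1 + 2 * B) / c ^+ 2 * c ^+ 2 = 1 + 2 * B by rewrite divfK// expf_neq0// gt_eqF.
  have := ler_wpM2l k0 v2; rewrite k1 /K => kv.
  have := mulr_ge0 k0 (sqr_ge0 (x - Re v)).
  have := sqr_ge0 (x - 2 * Re v); have := sqr_ge0 (Im v); nra.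
have zx : RtoC x - z != 0 by rewrite -opprB oppr_eq0 sub_RtoC_neq0.
have wx : RtoC x - w != 0 by rewrite -opprB oppr_eq0 sub_RtoC_neq0.
have -> : (1 + RtoC x * z) / (RtoC x - z) - (1 + RtoC x * w) / (RtoC x - w) =
    (z - w) * (RtoC (1 + x ^+ 2) * ((RtoC x - z)^-1 * (RtoC x - w)^-1)).
  have -> : RtoC (1 + x ^+ 2) = 1 + RtoC x ^+ 2.
    by apply: complex_ext; rewrite !expr2 !complex_parts /=; ring.
  by field; rewrite zx wx.
have {den} := (den z zc zB, den w wc wB).
move: (RtoC x - z)^-1 (RtoC x - w)^-1 => r s [hr hs].
rewrite mulrA (_ : _ * (z - w) = RtoC d2); last first.
  by apply: complex_ext; rewrite /d2 !complex_parts /=; ring.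
rewrite !complex_parts /= !mul0r !subr0 [leRHS]mulrC.
apply: ler_wpM2l; first by rewrite addr_ge0 ?sqr_ge0.
have x1 : 0 <= 1 + x ^+ 2 by rewrite addr_ge0 ?sqr_ge0.
(* The two squares give 2 Re (r s) <= |r|^2 + |s|^2. *)
have := mulr_ge0 x1 (sqr_ge0 (Re r - Re s)).
have := mulr_ge0 x1 (sqr_ge0 (Im r + Im s)).
nra.
Qed.

Lemma semigroup_equivariant (mu : R -> probability R R) (gamma : R)
    (tau : {finite_measure set R -> \bar R}) :
  associated_pair mu gamma tau -> reflection_equivariant (generatorA gamma tau) ->
  forall t, 0 <= t -> reflection_equivariant (cauchyH (mu t)).
Proof.
move=> pair Asym T T0 z z0; pose w := - (z^*)%C.
have w0 : 0 < Im w by rewrite Im_reflection.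
have Hpos t v : 0 < Im v -> 0 < Im (cauchyH (mu t) v).
  by apply: cauchyH_Im_gt0; exact: probability_setT.
pose k t := - ((cauchyH (mu t) w)^*)%C; pose h t := cauchyH (mu t) z.
have Ak t : generatorA gamma tau (cauchyH (mu t) w) = - ((generatorA gamma tau (k t))^*)%C.
  by rewrite /k Asym ?Hpos// conjcN opprK (conjcK (_ : R[i])).
have [|hz [dRz dIz]] := pair z; first by rewrite gt_eqF.
have [|hw [dRw dIw]] := pair w; first by rewrite gt_eqF.
have [p [pE dp]] := has_deriv_nonneg_extend dRz.
have [q [qE dq]] := has_deriv_nonneg_extend dIz.
have [p' [p'E dp']] := has_deriv_nonneg_extend dRw.
have [q' [q'E dq']] := has_deriv_nonneg_extend dIw.
have cont (f df : R -> R) : (forall t : R, 0 <= t -> is_derive t (1 : R) f (df t)) ->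
    {within `[0, T], continuous f}.
  move=> fdf; apply: derivable_within_continuous => x; rewrite in_itv/= => /andP[x0 _].
  by apply: ex_derive; exact: fdf.
(* Both trajectories stay in the open upper half-plane, so by compactness of [0, T] their imaginary
   parts have a positive lower bound. *)
have [c c0 [qc qc']] : exists2 c, 0 < c &
    (forall t, 0 <= t <= T -> c <= q t) /\ (forall t, 0 <= t <= T -> c <= q' t).
  have [s] := EVT_min T0 (cont _ _ dq); rewrite in_itv/= => /andP[s0 _] mins.
  have [s'] := EVT_min T0 (cont _ _ dq'); rewrite in_itv/= => /andP[s'0 _] mins'.
  exists (Num.min (q s) (q' s')).
    by rewrite lt_min qE// q'E// !Hpos.
  by split => t tT; rewrite ge_min ?mins ?mins' ?orbT.
have bounded (f df : R -> R) : (forall t : R, 0 <= t -> is_derive t (1 : R) f (df t)) ->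
    exists B, forall t, 0 <= t <= T -> f t ^+ 2 <= B.
  move=> fdf; have [|s _ smax] := @EVT_max R (fun t => f t ^+ 2) 0 T T0.
    apply: (cont _ (fun t => 2 * f t * df t)) => t t0; have ft := fdf t t0.
    have -> : (fun t => f t ^+ 2) = f ^+ 2 by [].
    apply: is_derive_eq; rewrite /GRing.scale/= expr1; ring.
  by exists (f s ^+ 2) => t tT; apply: smax.
have [B pB] := bounded _ _ dp; have [B' pB'] := bounded _ _ dp'.
have [K lip] := generator_lipschitz gamma tau (Num.max B B') c0.
(* The squared distance between [h] and [k]; the plus sign appears because the reflection in [k]
   negates the real part. *)
pose D (t : R) : R := (p t + p' t) ^+ 2 + (q t - q' t) ^+ 2.
have DE t : 0 <= t -> D t = Re (h t - k t) ^+ 2 + Im (h t - k t) ^+ 2.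
  by move=> t0; rewrite /D pE// qE// p'E// q'E// /k !complex_parts !opprK.
pose D' t := 2 * Re (((h t - k t)^*)%C *
  (generatorA gamma tau (h t) - generatorA gamma tau (k t))).
have dD (t : R) : 0 <= t <= T -> is_derive t (1 : R) D (D' t).
  move=> /andP[t0 _].
  have chain (a1 a2 a3 a4 : R) : is_derive t (1 : R) p a1 -> is_derive t (1 : R) q a2 ->
      is_derive t (1 : R) p' a3 -> is_derive t (1 : R) q' a4 ->
      is_derive t (1 : R) D (2 * ((p t + p' t) * (a1 + a3) + (q t - q' t) * (a2 - a4))).
    move=> d1 d2 d3 d4; have -> : D = (p + p') ^+ 2 + (q - q') ^+ 2 by [].
    apply: is_derive_eq; rewrite /GRing.scale/= !expr1.
    have -> : (p + p') t = p t + p' t by [].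
    have -> : (q - q') t = q t - q' t by [].
    ring.
  apply: is_derive_eq; first exact: chain (dp t t0) (dq t t0) (dp' t t0) (dq' t t0).
  rewrite pE// qE// p'E// q'E// !Ak /D' -/(h t).
  move: (generatorA gamma tau (h t)) (generatorA gamma tau (k t)) (h t) => a b c'.
  rewrite /k !complex_parts; ring.
have : D T <= 0.
  apply: (@gronwall_zero _ D' (2 * K)) => //.
    move=> t tT; have /andP[t0 _] := tT.
    rewrite DE// /D' -mulrA ler_pM2l//; apply: lip.
    - by rewrite -qE// qc.
    - by rewrite Im_reflection -q'E// qc'.
    - by rewrite -pE// le_max pB.
    - by rewrite !complex_parts sqrrN -p'E// le_max pB' ?orbT.
  rewrite DE// /h /k hz hw /w conjcN opprK (conjcK z) subrr/=; ring.
rewrite DE// => D0.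
apply/eqP; rewrite -subr_eq0 -/w.
have /eqP : D T = 0.
  by apply/eqP; rewrite eq_le DE// D0 addr_ge0 ?sqr_ge0.
rewrite DE// paddr_eq0 ?sqr_ge0// !sqrf_eq0 => /andP[/eqP e1 /eqP e2].
rewrite -/(h T); have {e1 e2}-> : h T = k T.
  apply/eqP; rewrite -subr_eq0; apply/eqP; exact: complex_ext.
rewrite /k conjcN opprK (conjcK (_ : R[i])) subrr//.
Qed.

End OdeUniqueness.

(** * Resolvents of a bounded random variable at infinity *)

Section CompositionalSquareRoot.
Context {R : realType}.
Local Notation C := R[i].
Local Notation Re := (@complex.Re R).
Local Notation Im := (@complex.Im R).

(** Closes both recursions used to pass from moments to transforms. *)
Lemma geometric_bound_eq0 (c : C) (A B M : R) : 0 <= B < A ->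
  (forall j, `|c| * ((A ^+ j)%:C)%C <= ((M * B ^+ j)%:C)%C) -> c = 0.
Proof.
move=> /andP[B0 BA] bnd; have A0 : 0 < A by apply: le_lt_trans BA.
pose n := Num.sqrt (Re c ^+ 2 + Im c ^+ 2).
have cn : `|c| = (n%:C)%C by rewrite normc_def.
apply/eqP; rewrite -normr_eq0 cn eq_complex/= eqxx andbT eq_le sqrtr_ge0 andbT.
have q1 : `|B / A| < 1.
  rewrite ger0_norm; last by rewrite divr_ge0// ltW.
  by rewrite ltr_pdivrMr ?mul1r.
have lim : (M * (B / A) ^+ j) @[j --> \oo] --> (0 : R).
  by rewrite -[X in _ --> X](mulr0 M); apply: cvgM; [exact: cvg_cst | exact: cvg_expr].
rewrite leNgt; apply/negP => n0; near \oo => j.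
have : M * (B / A) ^+ j < n by near: j; exact: (cvgr_lt 0 lim).
rewrite expr_div_n mulrA ltr_pdivrMr ?exprn_gt0// ltNge.
by have := bnd j; rewrite cn -rmorphM lecR => ->.
Unshelve. all: by end_near. Qed.

(* [R[i]] carries no canonical topology: limits are proved over an abstract [numFieldType] and
   then instantiated explicitly at [R[i]]. *)
Lemma cvg_of_dist_le (K : numFieldType) (a e : nat -> K) (d : K) :
  e n @[n --> \oo] --> (0 : K) -> (\forall n \near \oo, `|a n - d| <= `|e n|) ->
  a n @[n --> \oo] --> d.
Proof.
move=> e0 ae; apply/cvgrPdist_lt => eps eps0; near=> n.
rewrite distrC; apply: (@le_lt_trans _ _ `|e n|); first by near: n.
by near: n; move/cvgr0Pnorm_lt : e0; exact.
Unshelve. all: by end_near. Qed.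

Lemma cvg0_of_norm_lt (K : numFieldType) (a : nat -> K) :
  (forall e, 0 < e -> \forall n \near \oo, `|a n| < e) -> a n @[n --> \oo] --> (0 : K).
Proof. by move=> a0; apply/cvgr0Pnorm_lt. Qed.

Lemma norm_lt_of_cvg0 (K : numFieldType) (a : nat -> K) (e : K) :
  a n @[n --> \oo] --> (0 : K) -> 0 < e -> \forall n \near \oo, `|a n| < e.
Proof. by move=> /cvgr0Pnorm_lt; apply. Qed.

Lemma cvg0_pair_bound (K : numFieldType) (a b : nat -> K) (c : K) :
  a n @[n --> \oo] --> (0 : K) -> b n @[n --> \oo] --> (0 : K) ->
  (2 * (c * `|a n| + c * `|b n| + c * `|a n| * (c * `|b n|))) @[n --> \oo] --> (0 : K).
Proof.
move=> a0 b0.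
have ca : (c * `|a n|) @[n --> \oo] --> (0 : K).
  by rewrite -[X in _ --> X](mulr0 c) -(@normr0 K K); apply: cvgM;
     [exact: cvg_cst | exact: cvg_norm].
have cb : (c * `|b n|) @[n --> \oo] --> (0 : K).
  by rewrite -[X in _ --> X](mulr0 c) -(@normr0 K K); apply: cvgM;
     [exact: cvg_cst | exact: cvg_norm].
rewrite [X in _ --> X](_ : 0 = 2 * (0 + 0 + 0 * 0)); last by rewrite mulr0 !addr0 mulr0.
by apply: cvgM; [exact: cvg_cst | apply: cvgD; [exact: cvgD | exact: cvgM]].
Qed.

Lemma cvg0_mull (K : numFieldType) (a : nat -> K) (c : K) :
  a n @[n --> \oo] --> (0 : K) -> (c * a n) @[n --> \oo] --> (0 : K).
Proof. by move=> a0; rewrite -[X in _ --> X](mulr0 c); apply: cvgM => //; exact: cvg_cst. Qed.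

(** Passing to the limit gives d = - d. This is the end of the moment comparison, with p and q the
    correction factors tending to 1. *)
Lemma cvg_neg_product (K : numFieldType) (a b p q : nat -> K) (d : K) k :
  a n @[n --> \oo] --> d -> b n @[n --> \oo] --> d ->
  p n @[n --> \oo] --> (1 : K) -> q n @[n --> \oo] --> (1 : K) ->
  (forall n, a n * p n ^+ k = - (b n * q n)) -> d = 0.
Proof.
move=> ad bd p1 q1 ab.
have pk : (p n ^+ k) @[n --> \oo] --> (1 : K).
  elim: k {ab} => [|k IH]; first by under eq_fun do rewrite expr0; exact: cvg_cst.
  have -> : (fun n => p n ^+ k.+1) = (fun n => p n * p n ^+ k).
    by apply/funext => n; rewrite exprS.
  by rewrite -[X in _ --> X](mulr1 1); exact: cvgM.
have l1 : (a n * p n ^+ k) @[n --> \oo] --> d * 1 by exact: cvgM.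
have l2 : (a n * p n ^+ k) @[n --> \oo] --> - (d * 1).
  have -> : (fun n => a n * p n ^+ k) = (fun n => - (b n * q n)) by exact/funext.
  by apply: cvgN; exact: cvgM.
have e : d * 1 = - (d * 1) by exact: (cvg_unique (@norm_hausdorff _ K) l1 l2).
by move: e => /eqP; rewrite mulr1 -addr_eq0 -mulr2n mulrn_eq0 => /eqP.
Qed.

Definition imaginary_seq (n : nat) : C := Complex 0 n.+1%:R.

Lemma cvg_imaginary_seqV : (imaginary_seq n)^-1 @[n --> \oo] --> (0 : (C : numFieldType)).
Proof.
apply: (@cvg0_of_norm_lt C) => e e0.
have eE : e = ((Re e)%:C)%C.
  by rewrite RRe_real// gtr0_real.
have {}e0 : 0 < Re e by rewrite eE ltcR in e0.
near=> n; rewrite normfV normc_def /= expr0n/= add0r sqrtr_sqr normr_nat eE -fmorphV ltcR.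
rewrite invf_plt ?posrE ?ltr0n//; apply: (@lt_le_trans _ _ n%:R); last by rewrite ler_nat.
by near: n; exact: nbhs_infty_gtr.
Unshelve. all: by end_near. Qed.

Definition power_resolvent (mu : {measure set R -> \bar R}) (X : R -> R) k m (w : C) :=
  cintegral mu (fun x => RtoC (X x) ^+ k * (w - RtoC (X x))^-1 ^+ m).

Section RandomVariables.
Variables (mu : {measure set R -> \bar R}) (r : R).
Hypotheses (mu1 : mu setT = 1%E) (r0 : 0 < r).
Local Notation E := (cintegral mu).

Let fin : (mu setT < +oo)%E. Proof. by rewrite mu1 ltry. Qed.

Lemma cintegral1 : E (fun=> 1) = 1.
Proof. by rewrite cintegral_cst// mu1 mul1r. Qed.

Lemma norm_cintegral_prob F (M : C) : cbounded_meas F ->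
  (forall x, `|F x| <= M) -> `|E F| <= 2 * M.
Proof.
move=> bF FM; have ME : M = ((Re M)%:C)%C.
  by rewrite RRe_real// ger0_real// (le_trans _ (FM 0)).
have := @norm_cintegral_le _ mu fin F (Re M) bF; rewrite -ME mu1 mulr1 => /(_ FM).
by rewrite rmorphM/= -ME rmorph_nat.
Qed.

Lemma norm_ge_Im (z : C) : (`|Im z|%:C)%C <= `|z|.
Proof. by rewrite normc_def lecR -sqrtr_sqr ler_wsqrtr// lerDr sqr_ge0. Qed.

Lemma norm_RtoC (x : R) : `|RtoC x| = (`|x|%:C)%C.
Proof. by rewrite normc_def /= expr0n/= addr0 sqrtr_sqr. Qed.

Lemma near_far (w : nat -> C) : (forall n, Im (w n) != 0) ->
  (w n)^-1 @[n --> \oo] --> (0 : (C : numFieldType)) ->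
  \forall n \near \oo, ((2 * r)%:C)%C <= `|w n|.
Proof.
move=> w0 wV; have far := @norm_lt_of_cvg0 C _ (((2 * r)^-1)%:C)%C wV.
near=> n; rewrite -lef_pV2 ?posrE; last 2 first.
- by rewrite normr_gt0 Im_neq0.
- by rewrite ltcR mulr_gt0.
rewrite -normfV -fmorphV ltW//; near: n; apply: far.
by rewrite ltcR invr_gt0 mulr_gt0.
Unshelve. all: by end_near. Qed.

Section OneVariable.
Variable X : R -> R.
Hypotheses (mX : measurable_fun [set: R] X) (Xr : forall x, `|X x| <= r).
Implicit Types (z w : C).

Let bX : cbounded_meas (fun x => RtoC (X x)).
Proof. by apply: cbounded_meas_real; split=> //; exists r. Qed.

Lemma power_resolvent_cbounded k m w : Im w != 0 ->
  cbounded_meas (fun x => RtoC (X x) ^+ k * (w - RtoC (X x))^-1 ^+ m).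
Proof.
by move=> w0; apply: cbounded_measM; apply: cbounded_measX => //; exact: cbounded_meas_resolvent.
Qed.

(** From w / (w - X) = 1 + X / (w - X). The same identity drives the expansion at infinity (m = 0)
    and the recovery of transforms from moments (all m). *)
Lemma power_resolventE k m w : Im w != 0 ->
  w * power_resolvent mu X k m.+1 w =
  power_resolvent mu X k m w + power_resolvent mu X k.+1 m.+1 w.
Proof.
move=> w0; rewrite -cintegralZ -?cintegralD//; try exact: power_resolvent_cbounded.
apply: eq_cintegral => x; have wx := sub_RtoC_neq0 (X x) w0.
by rewrite !exprS; field.
Qed.

Lemma norm_resolvent_le w x : Im w != 0 ->
  `|(w - RtoC (X x))^-1| <= (`|Im w|^-1%:C)%C.
Proof.
move=> w0; rewrite normfV fmorphV lef_pV2 ?posrE ?normr_gt0 ?sub_RtoC_neq0//.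
  by apply: le_trans (norm_ge_Im _); rewrite complex_parts /= subr0.
by rewrite ltcR normr_gt0.
Qed.

(** For |w| >= 2 r the triangle inequality gives |w - X| >= |w| - r >= |w| / 2. *)
Lemma norm_resolvent_far w x : ((2 * r)%:C)%C <= `|w| ->
  `|(w - RtoC (X x))^-1| <= 2 * `|w|^-1.
Proof.
move=> wr; have w0 : 0 < `|w| by apply: lt_le_trans wr; rewrite ltcR mulr_gt0.
have wx : 0 < `|w - RtoC (X x)|.
  rewrite normr_gt0; apply: contraTneq wr => /eqP; rewrite subr_eq0 => /eqP ->.
  rewrite norm_RtoC lecR -ltNge (le_lt_trans (Xr x))//.
  by rewrite mulr_natl mulr2n ltrDl.
rewrite normfV ler_pdivlMr// ler_pdivrMl//.
have tri : `|w| <= `|w - RtoC (X x)| + `|RtoC (X x)|.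
  by rewrite -{1}[w](subrK (RtoC (X x))) ler_normD.
rewrite -(lerD2r `|w|); apply: le_trans (lerD tri tri) _.
have -> (a b : C) : a + b + (a + b) = a * 2 + 2 * b by ring.
rewrite lerD2l; apply: le_trans wr.
by rewrite norm_RtoC rmorphM rmorph_nat ler_pM2l// lecR.
Qed.

Lemma norm_power_le k x : `|RtoC (X x) ^+ k| <= ((r ^+ k)%:C)%C.
Proof.
by rewrite normrX norm_RtoC -rmorphXn lecR lerXn2r ?nnegrE// ltW.
Qed.

Lemma cvg_power_resolvent (w : nat -> C) k : (forall n, Im (w n) != 0) ->
  (w n)^-1 @[n --> \oo] --> (0 : (C : numFieldType)) ->
  (w n * E (fun x => RtoC (X x) ^+ k * (w n - RtoC (X x))^-1)) @[n --> \oo] -->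
  (E (fun x => RtoC (X x) ^+ k) : (C : numFieldType)).
Proof.
(* The outer 2 comes from [norm_cintegral_prob], the inner one from [norm_resolvent_far], and the
   power of r bounds the factor X^(k+1) of the error term. *)
move=> w0 wV; pose c : C := 2 * (RtoC (r ^+ k.+1) * 2).
apply: (@cvg_of_dist_le C _ (fun n => c * (w n)^-1)); first exact: cvg0_mull.
near=> n.
have wr : ((2 * r)%:C)%C <= `|w n| by near: n; exact: near_far.
have -> : w n * E (fun x => RtoC (X x) ^+ k * (w n - RtoC (X x))^-1) -
    E (fun x => RtoC (X x) ^+ k) = E (fun x => RtoC (X x) ^+ k.+1 * (w n - RtoC (X x))^-1).
  have -> : E (fun x => RtoC (X x) ^+ k) = power_resolvent mu X k 0 (w n).
    by apply: eq_cintegral => x; rewrite expr0 mulr1.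
  apply/eqP; rewrite subr_eq addrC; apply/eqP; exact: (power_resolventE k 0 (w0 n)).
rewrite normrM ger0_norm; last by rewrite /c !mulr_ge0 ?lecR ?exprn_ge0 1?ltW.
rewrite /c -!mulrA; apply: norm_cintegral_prob.
  by have := power_resolvent_cbounded k.+1 1 (w0 n); under eq_fun do rewrite expr1.
move=> x; rewrite normrM; apply: ler_pM => //; first exact: norm_power_le.
by rewrite [X in 2 * X]normfV; exact: norm_resolvent_far.
Unshelve. all: by end_near. Qed.

Lemma cvg_resolvent (w : nat -> C) : (forall n, Im (w n) != 0) ->
  (w n)^-1 @[n --> \oo] --> (0 : (C : numFieldType)) ->
  (w n * E (fun x => (w n - RtoC (X x))^-1)) @[n --> \oo] --> (1 : (C : numFieldType)).
Proof.
move=> w0 wV; have := @cvg_power_resolvent w 0 w0 wV.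
have -> : E (fun x => RtoC (X x) ^+ 0) = 1 by rewrite -[RHS]cintegral1.
suff -> : (fun n => w n * E (fun x => RtoC (X x) ^+ 0 * (w n - RtoC (X x))^-1)) =
    (fun n => w n * E (fun x => (w n - RtoC (X x))^-1)) by [].
by apply/funext => n; congr (_ * _); apply: eq_cintegral => x; rewrite expr0 mul1r.
Qed.

(** Since u / (u - X) = 1 + X / (u - X), and likewise for v, the product minus 1 is a + b + a b with
    a = O(1/u) and b = O(1/v). *)
Lemma cvg_double_resolvent (u v : nat -> C) :
  (forall n, Im (u n) != 0) -> (forall n, Im (v n) != 0) ->
  (u n)^-1 @[n --> \oo] --> (0 : (C : numFieldType)) ->
  (v n)^-1 @[n --> \oo] --> (0 : (C : numFieldType)) ->
  (u n * v n * E (fun x => (u n - RtoC (X x))^-1 * (v n - RtoC (X x))^-1)) @[n --> \oo]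
  --> (1 : (C : numFieldType)).
Proof.
move=> u0 v0 uV vV; pose c : C := RtoC r * 2.
apply: (@cvg_of_dist_le C); first exact: (@cvg0_pair_bound C _ _ c uV vV).
near=> n.
have ur : ((2 * r)%:C)%C <= `|u n| by near: n; exact: near_far.
have vr : ((2 * r)%:C)%C <= `|v n| by near: n; exact: near_far.
have bu := cbounded_meas_resolvent mX (u0 n).
have bv := cbounded_meas_resolvent mX (v0 n).
have bXu := cbounded_measM bX bu; have bXv := cbounded_measM bX bv.
have bXX := cbounded_measM bXu bXv.
have c0 : 0 <= c by rewrite mulr_ge0// lecR ltW.
have -> : u n * v n * E (fun x => (u n - RtoC (X x))^-1 * (v n - RtoC (X x))^-1) - 1 =
    E (fun x => RtoC (X x) * (u n - RtoC (X x))^-1 + RtoC (X x) * (v n - RtoC (X x))^-1 +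
      RtoC (X x) * (u n - RtoC (X x))^-1 * (RtoC (X x) * (v n - RtoC (X x))^-1)).
  rewrite -cintegralZ//; last exact: cbounded_measM.
  rewrite -cintegral1 -cintegralB//; last exact: cbounded_meas_cst.
    apply: eq_cintegral => x; have ux := sub_RtoC_neq0 (X x) (u0 n).
    have vx := sub_RtoC_neq0 (X x) (v0 n).
    by field; rewrite ux vx.
  apply: cbounded_measM; first exact: cbounded_meas_cst.
  exact: cbounded_measM.
rewrite [leRHS]ger0_norm; last first.
  by do ?[exact: c0 | exact: normr_ge0 | exact: ler0n | apply: addr_ge0 | apply: mulr_ge0].
apply: norm_cintegral_prob.
  by apply: cbounded_measD => //; exact: cbounded_measD.
move=> x.
have bnd w : ((2 * r)%:C)%C <= `|w| ->
    `|RtoC (X x) * (w - RtoC (X x))^-1| <= c * `|w^-1|.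
  move=> wr; rewrite normrM /c -mulrA; apply: ler_pM => //.
    by rewrite norm_RtoC lecR.
  by rewrite [X in 2 * X]normfV; exact: norm_resolvent_far.
apply: le_trans (ler_normD _ _) _; apply: lerD.
  by apply: le_trans (ler_normD _ _) _; apply: lerD; exact: bnd.
by rewrite normrM; apply: ler_pM => //; exact: bnd.
Unshelve. all: by end_near. Qed.
End OneVariable.

End RandomVariables.
End CompositionalSquareRoot.

(** * Equal moments give equal transforms *)

Section Recursions.
Context {R : realType}.
Local Notation C := R[i].
Local Notation Im := (@complex.Im R).

Lemma real_complexX (x : R) j : ((x ^+ j)%:C)%C = (x%:C)%C ^+ j :> C.
Proof. exact: rmorphXn. Qed.

Lemma real_complexM (x y : R) : ((x * y)%:C)%C = (x%:C)%C * (y%:C)%C :> C.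
Proof. exact: rmorphM. Qed.

Lemma real_complexD (x y : R) : ((x + y)%:C)%C = (x%:C)%C + (y%:C)%C :> C.
Proof. exact: rmorphD. Qed.

Lemma real_complex_nat n : (n%:R%:C)%C = n%:R :> C.
Proof. exact: rmorph_nat. Qed.

Lemma norm_exp_le (z : C) (b : R) n : `|z| <= (b%:C)%C -> `|z ^+ n| <= ((b ^+ n)%:C)%C.
Proof.
move=> zb; rewrite normrX real_complexX; apply: lerXn2r => //; rewrite nnegrE//.
exact: le_trans zb.
Qed.

(** Once column m vanishes, the recursion in column m + 1 reads w a_k = a_(k+1). Its solutions grow
    like |w|^k, at least |Im w|^k, which the bound by r^k excludes unless they vanish. *)
Lemma double_recursion_eq0 (a : nat -> nat -> C) (w : C) (r : R) (c : nat -> R) :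
  0 < r < `|Im w| -> (forall k, a k 0%N = 0) ->
  (forall k m, w * a k m.+1 = a k m + a k.+1 m.+1) ->
  (forall k m, `|a k m| <= ((c m * r ^+ k)%:C)%C) ->
  forall m k, a k m = 0.
Proof.
move=> /andP[r0 rw] a0 aS bnd; elim=> [//|m IH] k.
have iter j : w ^+ j * a k m.+1 = a (k + j)%N m.+1.
  elim: j => [|j IHj]; first by rewrite expr0 mul1r addn0.
  by rewrite exprS -mulrA IHj aS IH add0r addnS.
apply: (@geometric_bound_eq0 _ _ `|Im w| r (c m.+1 * r ^+ k)).
  by rewrite rw ltW.
move=> j; apply: (@le_trans _ _ `|a (k + j)%N m.+1|).
  rewrite -iter normrM mulrC ler_wpM2r// normrX real_complexX.
  by apply: lerXn2r; [rewrite nnegrE lecR | rewrite nnegrE | exact: norm_ge_Im].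
by apply: le_trans (bnd _ _) _; rewrite exprD mulrA.
Qed.

Lemma geometric_recursion_eq0 (b : nat -> C) (i : C) (A B M : R) : 0 <= B < A ->
  `|i| = (B%:C)%C -> (forall m, b m = i * b m.+1) ->
  (forall m, `|b m| * ((A ^+ m)%:C)%C <= (M%:C)%C) -> b 0%N = 0.
Proof.
move=> BA iB bS bnd; have /andP[B0 _] := BA.
have iter m : b 0%N = i ^+ m * b m.
  by elim: m => [|m IH]; rewrite ?expr0 ?mul1r// IH bS exprSr mulrA.
apply: (geometric_bound_eq0 BA) => m.
rewrite (iter m) normrM normrX iB real_complexM (real_complexX B) -mulrA mulrC.
by apply: ler_wpM2r (bnd m); rewrite exprn_ge0// lecR.
Qed.
End Recursions.

Section TwoVariables.
Context {R : realType}.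
Local Notation C := R[i].
Local Notation Re := (@complex.Re R).
Local Notation Im := (@complex.Im R).
Variables (mu : {measure set R -> \bar R}) (r : R).
Hypotheses (mu1 : mu setT = 1%E) (r0 : 0 < r).
Local Notation E := (cintegral mu).

Let fin : (mu setT < +oo)%E. Proof. by rewrite mu1 ltry. Qed.

Variables X Y : R -> R.
Hypotheses (mX : measurable_fun [set: R] X) (Xr : forall x, `|X x| <= r).
Hypotheses (mY : measurable_fun [set: R] Y) (Yr : forall x, `|Y x| <= r).
Implicit Types (z w : C).

Local Notation GX z := (E (fun x => (z - RtoC (X x))^-1)).
Local Notation GY z := (E (fun x => (z - RtoC (Y x))^-1)).

Lemma norm_power_resolvent_le (Z : R -> R) k m w : measurable_fun [set: R] Z ->
  (forall x, `|Z x| <= r) -> Im w != 0 ->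
  `|power_resolvent mu Z k m w| <= ((2 * (r ^+ k * `|Im w|^-1 ^+ m))%:C)%C.
Proof.
move=> mZ Zr w0; rewrite real_complexM real_complex_nat.
apply: (norm_cintegral_prob mu1); first exact: (power_resolvent_cbounded mZ Zr).
move=> x; rewrite normrM real_complexM; apply: ler_pM => //; first exact: (norm_power_le r0 Zr).
by apply: norm_exp_le; exact: norm_resolvent_le.
Qed.

Lemma power_resolvent_m0 (Z : R -> R) k w :
  power_resolvent mu Z k 0 w = E (fun x => RtoC (Z x) ^+ k).
Proof. by apply: eq_cintegral => x; rewrite expr0 mulr1. Qed.

Lemma power_resolvent_01 (Z : R -> R) w :
  power_resolvent mu Z 0 1 w = E (fun x => (w - RtoC (Z x))^-1).
Proof. by apply: eq_cintegral => x; rewrite expr0 mul1r expr1. Qed.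

Lemma eq_moments_resolvent_powers :
  (forall k, E (fun x => RtoC (X x) ^+ k) = E (fun x => RtoC (Y x) ^+ k)) ->
  forall w, r < `|Im w| ->
  forall m k, power_resolvent mu X k m w - power_resolvent mu Y k m w = 0.
Proof.
move=> mXY w rw; have w0 : Im w != 0 by rewrite -normr_gt0; apply: lt_trans rw.
apply: (@double_recursion_eq0 R
  (fun k m => power_resolvent mu X k m w - power_resolvent mu Y k m w)
  w r (fun m => 4 * `|Im w|^-1 ^+ m)) => [|k|k m|k m]; first by rewrite r0.
- by rewrite !power_resolvent_m0 mXY subrr.
- have comb (a b c d e f : C) : w * a = c + e -> w * b = d + f ->
      w * (a - b) = (c - d) + (e - f).
    by move=> e1 e2; rewrite mulrBr e1 e2 opprD addrACA.
  exact: comb (power_resolventE mu1 mX Xr k m w0) (power_resolventE mu1 mY Yr k m w0).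
- apply: le_trans (ler_normB _ _) _.
  have := lerD (norm_power_resolvent_le k m mX Xr w0) (norm_power_resolvent_le k m mY Yr w0).
  by move=> /le_trans; apply; rewrite -real_complexD lecR; lra.
Qed.

(* [1/(z - x)] is expanded in powers of [1/(w - x)] around the point [w = z + i N], which is
   closer to [z] than to the real line, and these powers are in turn polynomially approximable
   on [[-r, r]] because [N > r]. *)
Lemma eq_moments_transform :
  (forall k, E (fun x => RtoC (X x) ^+ k) = E (fun x => RtoC (Y x) ^+ k)) ->
  forall z, 0 < Im z -> GX z = GY z.
Proof.
move=> mXY z z0; pose N := r + 1; pose i : C := Complex 0 N; pose w := z + i.
have N0 : 0 < N by rewrite addr_gt0.
have wE : Im w = Im z + N by rewrite complex_parts.
have wN : N < Im w by rewrite wE ltrDr.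
have w0 : Im w != 0 by rewrite gt_eqF// (lt_trans N0).
have z0' : Im z != 0 by rewrite gt_eqF.
have rw : r < `|Im w|.
  by apply: lt_le_trans (ler_norm _); apply: lt_trans wN; rewrite ltrDl.
have pow0 := eq_moments_resolvent_powers mXY rw.
(* The difference of the two remainders after m terms of the geometric expansion. One more term
   comes from 1/(z - x) = 1/(w - x) + i / ((w - x)(z - x)), where [i] stands for w - z; the expanded
   terms cancel by [pow0]. *)
pose rem m := E (fun x => (w - RtoC (X x))^-1 ^+ m * (z - RtoC (X x))^-1) -
              E (fun x => (w - RtoC (Y x))^-1 ^+ m * (z - RtoC (Y x))^-1).
have bZ (Z : R -> R) m : measurable_fun [set: R] Z ->
    cbounded_meas (fun x => (w - RtoC (Z x))^-1 ^+ m * (z - RtoC (Z x))^-1).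
  by move=> mZ; apply: cbounded_measM; [apply: cbounded_measX|]; exact: cbounded_meas_resolvent.
have remS m : rem m = i * rem m.+1.
  have step (Z : R -> R) : measurable_fun [set: R] Z -> (forall x, `|Z x| <= r) ->
      E (fun x => (w - RtoC (Z x))^-1 ^+ m * (z - RtoC (Z x))^-1) =
      power_resolvent mu Z 0 m.+1 w +
      i * E (fun x => (w - RtoC (Z x))^-1 ^+ m.+1 * (z - RtoC (Z x))^-1).
    move=> mZ Zr; rewrite -cintegralZ; [|exact: fin|exact: bZ].
    rewrite -cintegralD; [|exact: fin|exact: (power_resolvent_cbounded mZ Zr)|].
      apply: eq_cintegral => x; have wx := sub_RtoC_neq0 (Z x) w0.
      have zx := sub_RtoC_neq0 (Z x) z0'.
      rewrite expr0 mul1r exprS /w in wx *; field; rewrite zx wx//.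
    by apply: cbounded_measM; [exact: cbounded_meas_cst | exact: bZ].
  have comb (a b c d p q : C) : p - q = 0 -> a = p + i * c -> b = q + i * d ->
      a - b = i * (c - d).
    by move=> /eqP; rewrite subr_eq0 => /eqP -> -> ->; rewrite opprD addrACA subrr add0r mulrBr.
  exact: comb (pow0 m.+1 0%N) (step X mX Xr) (step Y mY Yr).
have bnd m : `|rem m| * ((Im w ^+ m)%:C)%C <= ((4 * `|Im z|^-1)%:C)%C.
  have bndZ (Z : R -> R) : measurable_fun [set: R] Z -> (forall x, `|Z x| <= r) ->
      `|E (fun x => (w - RtoC (Z x))^-1 ^+ m * (z - RtoC (Z x))^-1)| <=
      2 * (((`|Im w|^-1 ^+ m)%:C)%C * (`|Im z|^-1%:C)%C).
    move=> mZ Zr; apply: (norm_cintegral_prob mu1); first exact: bZ.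
    move=> x; rewrite normrM; apply: ler_pM => //; last exact: norm_resolvent_le.
    by apply: norm_exp_le; exact: norm_resolvent_le.
  have rem_le := le_trans (ler_normB _ _) (lerD (bndZ X mX Xr) (bndZ Y mY Yr)).
  have wm : 0 < Im w ^+ m by rewrite exprn_gt0// (lt_trans N0).
  have := ler_wpM2r (_ : 0 <= ((Im w ^+ m)%:C)%C) rem_le.
  rewrite lecR ltW// => /(_ isT)/le_trans; apply.
  rewrite -real_complex_nat -!real_complexM -real_complexD -real_complexM lecR.
  rewrite gtr0_norm ?(lt_trans N0)// exprVn.
  move: (Im w ^+ m) wm => q q0; move: `|Im z|^-1 => s.
  by rewrite le_eqVlt; apply/orP; left; apply/eqP; field; rewrite gt_eqF.
have iN : `|i| = (N%:C)%C.
  by rewrite normc_def /= expr0n/= add0r sqrtr_sqr gtr0_norm.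
have := @geometric_recursion_eq0 R rem i (Im w) N _ _ iN remS bnd.
rewrite wN ltW// => /(_ isT)/eqP; rewrite subr_eq0 => /eqP e.
transitivity (E (fun x => (w - RtoC (X x))^-1 ^+ 0 * (z - RtoC (X x))^-1)).
  by apply: eq_cintegral => x; rewrite expr0 mul1r.
by rewrite e; apply: eq_cintegral => x; rewrite expr0 mul1r.
Qed.
End TwoVariables.

(** * Uniqueness of compositional square roots *)

Section SquareRootUniqueness.
Context {R : realType}.
Local Notation C := R[i].
Local Notation Re := (@complex.Re R).
Local Notation Im := (@complex.Im R).

Lemma cvg0_mul_cvg1 (K : numFieldType) (a b : nat -> K) :
  a n @[n --> \oo] --> (0 : K) -> b n @[n --> \oo] --> (1 : K) ->
  (a n * b n) @[n --> \oo] --> (0 : K).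
Proof. by move=> a0 b1; rewrite -[X in _ --> X](mul0r 1); exact: cvgM. Qed.

Lemma cvg_sub (K : numFieldType) (a b : nat -> K) (c d : K) :
  a n @[n --> \oo] --> c -> b n @[n --> \oo] --> d ->
  (a n - b n) @[n --> \oo] --> c - d.
Proof. by move=> ac bd; exact: cvgB. Qed.

Variables (mu : {measure set R -> \bar R}) (r : R).
Hypotheses (mu1 : mu setT = 1%E) (r0 : 0 < r).
Local Notation E := (cintegral mu).
Variables X Y : R -> R.
Hypotheses (mX : measurable_fun [set: R] X) (Xr : forall x, `|X x| <= r).
Hypotheses (mY : measurable_fun [set: R] Y) (Yr : forall x, `|Y x| <= r).
Implicit Types (z w : C).

Let fin : (mu setT < +oo)%E. Proof. by rewrite mu1 ltry. Qed.

(** The Cauchy transform of the law of Z under m, written without forming the law, so that two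
    variables are compared under a single measure. *)
Definition rv_transform (m : {measure set R -> \bar R}) (Z : R -> R) (z : C) : C :=
  cintegral m (fun x => (z - RtoC (Z x))^-1).
Local Notation G := (rv_transform mu).

Lemma rv_transform_Im_neq0 (Z : R -> R) z : measurable_fun [set: R] Z -> 0 < Im z ->
  G Z z != 0.
Proof. by move=> mZ z0; apply: Im_neq0; rewrite lt_eqF// Im_resolvent_integral_lt0. Qed.

Lemma rv_transform_resolvent_identity (Z : R -> R) u v : measurable_fun [set: R] Z ->
  Im u != 0 -> Im v != 0 ->
  G Z v - G Z u = (u - v) * E (fun x => (u - RtoC (Z x))^-1 * (v - RtoC (Z x))^-1).
Proof.
move=> mZ u0 v0.
have bu := cbounded_meas_resolvent mZ u0; have bv := cbounded_meas_resolvent mZ v0.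
rewrite -cintegralZ//; last exact: cbounded_measM.
rewrite /G -cintegralB//; apply: eq_cintegral => x.
have ux := sub_RtoC_neq0 (Z x) u0; have vx := sub_RtoC_neq0 (Z x) v0.
by field; rewrite ux vx.
Qed.

(** Each multiplication by w splits off one moment from the expansion at infinity; the lower moments
    agree and cancel in the difference. *)
Lemma eq_lower_moments k w : Im w != 0 ->
  (forall j, (j < k)%N -> E (fun x => RtoC (X x) ^+ j) = E (fun x => RtoC (Y x) ^+ j)) ->
  w ^+ k * (G X w - G Y w) = power_resolvent mu X k 1 w - power_resolvent mu Y k 1 w.
Proof.
move=> w0; elim: k => [|k IH] eqm; first by rewrite expr0 mul1r !power_resolvent_01.
rewrite exprS -mulrA IH; last by move=> j jk; apply: eqm; exact: ltnW.
have comb (a b c d e : C) : w * a = c + d -> w * b = c + e -> w * (a - b) = d - e.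
  by move=> e1 e2; rewrite mulrBr e1 e2 opprD addrACA subrr add0r.
apply: (comb _ _ _ _ _ (power_resolventE mu1 mX Xr k 0 w0)).
rewrite (power_resolvent_m0 mu X) eqm// -(power_resolvent_m0 mu Y k w).
exact: (power_resolventE mu1 mY Yr k 0 w0).
Qed.

(* If [d] is the first non-zero difference of moments, then [G X w - G Y w] is equivalent to
   [d / w^(k+1)] at infinity; with [u = 1 / G X z] and [v = 1 / G Y z] the hypothesis yields
   [G X u - G Y u = - (G X z - G Y z) (1 + o(1))] while [u] is equivalent to [z], so [d = - d]. *)
Lemma eq_square_eq_moments :
  (forall z, 0 < Im z -> G X (G X z)^-1 = G Y (G Y z)^-1) ->
  forall k, E (fun x => RtoC (X x) ^+ k) = E (fun x => RtoC (Y x) ^+ k).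
Proof.
move=> sq; elim/ltn_ind => k eqm.
have [z [zp zV]] : exists z : nat -> C, (forall n, 0 < Im (z n)) /\
    (z n)^-1 @[n --> \oo] --> (0 : (C : numFieldType)).
  by exists (@imaginary_seq R); split=> [n|]; [rewrite /= ltr0n | exact: cvg_imaginary_seqV].
pose u n := (G X (z n))^-1; pose v n := (G Y (z n))^-1.
have up n : 0 < Im (u n) by apply: Im_inv_gt0; exact: Im_resolvent_integral_lt0.
have vp n : 0 < Im (v n) by apply: Im_inv_gt0; exact: Im_resolvent_integral_lt0.
have z0 n : Im (z n) != 0 by rewrite gt_eqF.
have u0 n : Im (u n) != 0 by rewrite gt_eqF.
have v0 n : Im (v n) != 0 by rewrite gt_eqF.
have GX1 := cvg_resolvent mu1 r0 mX Xr z0 zV.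
have GY1 := cvg_resolvent mu1 r0 mY Yr z0 zV.
have uV : (u n)^-1 @[n --> \oo] --> (0 : (C : numFieldType)).
  have -> : (fun n => (u n)^-1) = (fun n => (z n)^-1 * (z n * G X (z n))).
    by apply/funext => n; rewrite /u invrK mulKf// Im_neq0.
  exact: (@cvg0_mul_cvg1 C _ _ zV GX1).
have vV : (v n)^-1 @[n --> \oo] --> (0 : (C : numFieldType)).
  have -> : (fun n => (v n)^-1) = (fun n => (z n)^-1 * (z n * G Y (z n))).
    by apply/funext => n; rewrite /v invrK mulKf// Im_neq0.
  exact: (@cvg0_mul_cvg1 C _ _ zV GY1).
have Q1 := cvg_double_resolvent mu1 r0 mY Yr u0 v0 uV vV.
(* Equal to w^(k+1) (G X w - G Y w) as the lower moments agree, and convergent at infinity to the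
   difference of the k-th moments. *)
pose D w := w * E (fun x => RtoC (X x) ^+ k * (w - RtoC (X x))^-1) -
            w * E (fun x => RtoC (Y x) ^+ k * (w - RtoC (Y x))^-1).
have Dlim (w : nat -> C) : (forall n, Im (w n) != 0) ->
    (w n)^-1 @[n --> \oo] --> (0 : (C : numFieldType)) ->
    D (w n) @[n --> \oo] --> (E (fun x => RtoC (X x) ^+ k) - E (fun x => RtoC (Y x) ^+ k)
      : (C : numFieldType)).
  move=> w0 wV; apply: (@cvg_sub C).
    exact: (cvg_power_resolvent mu1 r0 mX Xr w0 wV).
  exact: (cvg_power_resolvent mu1 r0 mY Yr w0 wV).
have DE w : Im w != 0 -> D w = w ^+ k.+1 * (G X w - G Y w).
  move=> w0; rewrite exprS -mulrA eq_lower_moments//.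
  by rewrite mulrBr.
apply/eqP; rewrite -subr_eq0; apply/eqP.
apply: (@cvg_neg_product C _ _ _ _ _ k.+1 (Dlim _ u0 uV) (Dlim _ z0 zV) GX1 Q1) => n.
rewrite !DE// -/(G X (z n)).
(* By hypothesis G X u = G Y v, hence G X u - G Y u = (u - v) Q. As u and v are reciprocals, u - v =
   - u v (G X z - G Y z), which produces the decisive minus sign. *)
have := rv_transform_resolvent_identity mY (u0 n) (v0 n).
rewrite -sq// -/(u n) => ->.
have := Im_neq0 (z0 n).
have := rv_transform_Im_neq0 mX (zp n); have := rv_transform_Im_neq0 mY (zp n).
move: (cintegral mu (fun x => (u n - RtoC (Y x))^-1 * (v n - RtoC (Y x))^-1)) => Q.
rewrite /u /v; move: (G Y (z n)) => b; move: (G X (z n)) => a; move: (z n) => y b0 a0 y0.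
have e : a^-1 ^+ k.+1 * a ^+ k.+1 = 1 by rewrite -exprMn mulVf// expr1n.
rewrite exprMn; transitivity ((a^-1 ^+ k.+1 * a ^+ k.+1) * (y ^+ k.+1 * ((a^-1 - b^-1) * Q))).
  by move: (a^-1 ^+ k.+1) (a ^+ k.+1) (y ^+ k.+1) => p q s; ring.
by rewrite e; move: (y ^+ k.+1) => s; field; rewrite a0 b0.
Qed.

Lemma eq_square_eq_transform :
  (forall z, 0 < Im z -> G X (G X z)^-1 = G Y (G Y z)^-1) ->
  forall z, 0 < Im z -> G X z = G Y z.
Proof.
move=> sq; apply: (eq_moments_transform mu1 r0 mX Xr mY Yr).
exact: eq_square_eq_moments.
Qed.
End SquareRootUniqueness.

(** * Compact supports and the theorem *)

Section CompactSupport.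
Context {R : realType}.
Local Notation C := R[i].
Local Notation Re := (@complex.Re R).
Local Notation Im := (@complex.Im R).
Implicit Types (z w : C).

(** A point off the support has a null open neighbourhood, hence a null interval with rational end
    points around it; there are only countably many of these. *)
Lemma null_outside_support (mu : {measure set R -> \bar R}) :
  mu.-negligible (~` msupport mu).
Proof.
pose I (q : rat * rat) : set R := `]ratr q.1, ratr q.2[%classic.
pose F n : set R := if unpickle n is Some q then
  if mu (I q) == 0%E then I q else set0 else set0.
have nF : mu.-negligible (\bigcup_n F n).
  apply: negligible_bigcup => n; rewrite /F; case: unpickle => [q|]; last exact: negligible_set0.
  case: eqP => [I0|_]; last exact: negligible_set0.
  by apply/negligibleP => //; exact: measurable_itv.
apply: negligibleS nF => x /=; rewrite /msupport/= => /existsNP[U /not_implyP[oU /not_implyP[Ux]]].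
move=> /negP; rewrite lt0e measure_ge0 andbT negbK => /eqP U0.
have /nbhs_ballP[e /= e0 xeU] : nbhs x U by exact: open_nbhs_nbhs.
have xe1 : x - e < x by rewrite ltrBlDr ltrDl.
have xe2 : x < x + e by rewrite ltrDl.
have [p /[!in_itv]/= /andP[p1 p2]] := rat_in_itvoo xe1.
have [q /[!in_itv]/= /andP[q1 q2]] := rat_in_itvoo xe2.
have IU : I (p, q) `<=` U.
  move=> y; rewrite /I /= in_itv/= => /andP[y1 y2]; apply: xeU.
  by rewrite /ball/= ltr_distlC; apply/andP; split; [exact: lt_trans y1 | exact: lt_trans q2].
have I0 : mu (I (p, q)) = 0%E.
  apply/eqP; rewrite eq_le measure_ge0 andbT -U0.
  by apply: le_measure; rewrite ?inE//; [exact: measurable_itv | exact: open_measurable].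
have FU n : F n x -> (\bigcup_n F n) x by move=> Fx; exists n.
apply: (FU (pickle (p, q))).
rewrite /F pickleK I0 eqxx /I set_itvE /mkset p2 q1.
exact: isT.
Qed.

Lemma compact_support_null (mu : {measure set R -> \bar R}) : compact (msupport mu) ->
  exists2 r, 0 < r & mu.-negligible [set x | r < `|x|].
Proof.
move=> /compact_bounded[M [_ bM]].
have bM' := bM (Num.max M 0 + 1).
exists (Num.max M 0 + 1); first by rewrite ltr_pwDr// le_max lexx orbT.
apply: negligibleS (null_outside_support mu) => x /= xr Sx.
suff : `|x| <= Num.max M 0 + 1 by rewrite leNgt xr.
by apply: bM' => //; rewrite ltr_pwDr// le_max lexx.
Qed.

(** Truncation to [-r, r]. It is bounded at every point, as the square root argument requires, and
    equals the identity almost everywhere for a measure that gives no mass to |x| > r. *)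
Definition clamp (r x : R) : R := Num.max (- r) (Num.min x r).

Lemma measurable_clamp r : measurable_fun [set: R] (clamp r).
Proof.
apply: measurable_maxr; first exact: measurable_cst.
by apply: measurable_minr => //; exact: measurable_cst.
Qed.

Lemma norm_clamp r x : 0 <= r -> `|clamp r x| <= r.
Proof.
move=> r0; rewrite ler_norml /clamp le_max lexx/= ge_max ge_min lexx orbT andbT.
lra.
Qed.

Lemma clamp_id r x : `|x| <= r -> clamp r x = x.
Proof.
rewrite ler_norml /clamp => /andP[rx xr].
by rewrite (min_idPl xr) (max_idPr rx).
Qed.

Lemma cauchyG_clamp (mu : {measure set R -> \bar R}) r z :
  mu.-negligible [set x | r < `|x|] -> Im z != 0 ->
  cauchyG mu z = rv_transform mu (clamp r) z.
Proof.
move=> rnull z0.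
have [b1 b2] := resolvent_cbounded z0.
have [c1 c2] := cbounded_meas_resolvent (measurable_clamp r) z0.
have ae (f : C -> R) : measurable_fun [set: R] (fun x => f (z - RtoC x)^-1) ->
    measurable_fun [set: R] (fun x => f (z - RtoC (clamp r x))^-1) ->
    \int[mu]_x f (z - RtoC x)^-1 = \int[mu]_x f (z - RtoC (clamp r x))^-1.
  move=> mf mg; congr fine; apply: ae_eq_integral => //.
  - exact/measurable_EFinP.
  - exact/measurable_EFinP.
  apply: negligibleS rnull => x /=; apply: contra_notP => /negP.
  by rewrite -leNgt => xr _; rewrite clamp_id.
apply: complex_ext => /=.
  by apply: (ae Re); [case: b1 | case: c1].
by apply: (ae Im); [case: b2 | case: c2].
Qed.

Lemma rv_transform_opp (mu : {measure set R -> \bar R}) (X : R -> R) z :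
  (mu setT < +oo)%E -> measurable_fun [set: R] X -> Im z != 0 ->
  rv_transform mu (fun x => - X x) z = - ((rv_transform mu X (- (z^*)%C))^*)%C.
Proof.
move=> fin mX z0; rewrite /rv_transform.
have rb : cbounded_meas (fun x => (- (z^*)%C - RtoC (X x))^-1).
  by apply: cbounded_meas_resolvent => //; rewrite Im_reflection.
rewrite -cintegral_conj// -cintegralN//.
  apply: eq_cintegral => x; rewrite RtoCN !conjcE (conjcK z) -invrN.
  by congr (_^-1); ring.
case: rb => rRe rIm; split.
  by under eq_fun do rewrite Reconj.
by under eq_fun do rewrite Imconj; exact: bounded_measN.
Qed.

(** The truncated identity X has the transform of [mu], and -X has its conjugate by the reflection.
    The square of the conjugate is the conjugate of the square, which the symmetry of [nu]
    identifies with the square itself; [eq_square_eq_transform] then applies to X and -X. *)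
Lemma square_root_equivariant (mu nu : {measure set R -> \bar R}) :
  mu setT = 1%E -> compact (msupport mu) -> is_monotone_conv mu mu nu ->
  reflection_equivariant (cauchyH nu) -> reflection_equivariant (cauchyH mu).
Proof.
move=> mu1 cmu sq nusym.
have fin : (mu setT < +oo)%E by rewrite mu1 ltry.
have [r r0 rnull] := compact_support_null cmu.
pose X := clamp r; pose Y x := - clamp r x.
have mX : measurable_fun [set: R] X by exact: measurable_clamp.
have mY : measurable_fun [set: R] Y by exact: measurable_funN.
have Xr x : `|X x| <= r by apply: norm_clamp; exact: ltW.
have Yr x : `|Y x| <= r by rewrite normrN; exact: Xr.
have GE z : 0 < Im z -> cauchyG mu z = rv_transform mu X z.
  by move=> z0; apply: cauchyG_clamp => //; rewrite gt_eqF.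
have YE z : 0 < Im z -> rv_transform mu Y z = - ((cauchyG mu (- (z^*)%C))^*)%C.
  by move=> z0; rewrite GE ?Im_reflection//; apply: rv_transform_opp => //; rewrite gt_eqF.
have Hp z : 0 < Im z -> 0 < Im (cauchyH mu z) by exact: cauchyH_Im_gt0.
have refl z : 0 < Im z -> 0 < Im (- (z^*)%C) by rewrite Im_reflection.
have XY z : 0 < Im z -> rv_transform mu X z = rv_transform mu Y z.
  apply: (eq_square_eq_transform mu1 r0 mX Xr mY Yr) => {}z z0.
  have nuE w : 0 < Im w -> rv_transform mu X (cauchyH mu w) = (cauchyH nu w)^-1.
    by move=> w0; rewrite -GE ?Hp// sq// /cauchyH invrK.
  have -> : (rv_transform mu X z)^-1 = cauchyH mu z by rewrite -GE.
  have -> : (rv_transform mu Y z)^-1 = - ((cauchyH mu (- (z^*)%C))^*)%C.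
    by rewrite YE// invrN conjc_inv.
  have w0 := Hp _ (refl z z0).
  rewrite YE ?refl// conjcN opprK (conjcK (cauchyH mu _)) GE// !nuE ?refl// nusym//.
  by rewrite invrN conjcN opprK conjc_inv (conjcK (cauchyH nu z)).
move=> z z0; rewrite /cauchyH conjc_inv -invrN; congr (_^-1).
by rewrite (GE z z0) XY// YE// conjcN opprK (conjcK (cauchyG mu _)).
Qed.

End CompactSupport.

(** * From one symmetric time to the generator through dyadic times *)

Section SemigroupSymmetry.
Context {R : realType}.
Variables (mu : R -> probability R R) (gamma : R) (tau : {finite_measure set R -> \bar R}).
Hypotheses (semi : monotone_semigroup mu) (pair : associated_pair mu gamma tau)
  (csupp : forall t : R, 0 <= t -> compact (msupport (mu t))).
Local Notation C := R[i].
Local Notation Re := (@complex.Re R).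
Local Notation Im := (@complex.Im R).

Lemma dyadic_equivariant t n : 0 < t -> reflection_equivariant (cauchyH (mu t)) ->
  reflection_equivariant (cauchyH (mu (t * 2^-1 ^+ n))).
Proof.
move=> t0 Ht; elim: n => [|n IH]; first by rewrite expr0 mulr1.
set s := t * 2^-1 ^+ n.+1.
have s0 : 0 <= s by rewrite mulr_ge0 ?exprn_ge0 1?ltW// invr_ge0.
apply: (square_root_equivariant (nu := mu (t * 2^-1 ^+ n))) => //.
- exact: probability_setT.
- exact: csupp.
have -> : t * 2^-1 ^+ n = s + s by rewrite /s exprS; field.
exact: semi.
Qed.

(** The points t / 2^n tend to 0 and are positive, so they avoid 0 and stay in the domain of the
    one-sided limit. *)
Lemma has_deriv_nonneg_dyadic (f f' : R -> R) t : 0 < t -> has_deriv_nonneg f f' ->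
  ((f (t * 2^-1 ^+ n) - f 0) / (t * 2^-1 ^+ n)) @[n --> \oo] --> f' 0.
Proof.
move=> t0 /(_ 0 (lexx 0)); under eq_fun do rewrite add0r.
move=> df; pose h n : R := t * 2^-1 ^+ n.
have hp n : 0 < h n by rewrite mulr_gt0 ?exprn_gt0// invr_gt0.
have h0 : h n @[n --> \oo] --> (0 : R).
  rewrite -[X in _ --> X](mulr0 t); apply: cvgM; first exact: cvg_cst.
  by apply: cvg_expr; rewrite gtr0_norm ?invr_gt0//; lra.
suff hw : h n @[n --> \oo] --> within [set h | 0 <= 0 + h] (0 : R)^'.
  exact: (cvg_comp _ _ hw df).
move=> A; rewrite /within/= => nA.
have nA' : \forall n \near \oo, h n != 0 -> 0 <= 0 + h n -> A (h n) by exact: (h0 _ nA).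
suff : \forall n \near \oo, A (h n) by [].
apply: filterS nA' => n; apply; first exact: lt0r_neq0.
by rewrite add0r ltW.
Qed.

(** At time 0 the transform is the identity, so the difference quotients along t / 2^n tend to A.
    Limits are taken part by part: the reflection negates real parts and preserves imaginary
    parts. *)
Lemma equivariant_generator_of_dyadic t : 0 < t ->
  (forall n, reflection_equivariant (cauchyH (mu (t * 2^-1 ^+ n)))) ->
  reflection_equivariant (generatorA gamma tau).
Proof.
move=> t0 Hn z z0.
have z0' : Im z != 0 by rewrite gt_eqF.
have w0' : Im (- (z^*)%C) != 0 by rewrite Im_reflection.
have [Hz [dRz dIz]] := pair z0'; have [Hw [dRw dIw]] := pair w0'.
pose h n : R := t * 2^-1 ^+ n.
have quot (part : C -> R) w : cauchyH (mu 0) w = w ->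
    has_deriv_nonneg (fun s => part (cauchyH (mu s) w))
      (fun s => part (generatorA gamma tau (cauchyH (mu s) w))) ->
    ((part (cauchyH (mu (h n)) w) - part w) / h n) @[n --> \oo] -->
    part (generatorA gamma tau w).
  by move=> Hw0 /(has_deriv_nonneg_dyadic t0); rewrite Hw0.
have Hneg n : cauchyH (mu (h n)) (- (z^*)%C) = - ((cauchyH (mu (h n)) z)^*)%C by exact: Hn.
have uniq (a b : R^nat) (x y : R) : a n @[n --> \oo] --> x -> b n @[n --> \oo] --> y ->
    a = b -> x = y.
  by move=> ax b_y ab; rewrite ab in ax; exact: (cvg_unique (@Rhausdorff R) ax b_y).
apply: complex_ext.
  have lz : (- ((Re (cauchyH (mu (h n)) z) - Re z) / h n)) @[n --> \oo] -->
      - Re (generatorA gamma tau z) by apply: cvgN; exact: quot.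
  rewrite ReN Reconj; apply: (uniq _ _ _ _ (quot _ _ Hw dRw) lz); apply/funext => n.
  by rewrite Hneg !ReN !Reconj; ring.
rewrite ImN Imconj opprK; apply: (uniq _ _ _ _ (quot _ _ Hw dIw) (quot _ _ Hz dIz)).
by apply/funext => n; rewrite Hneg !ImN !Imconj !opprK.
Qed.

End SemigroupSymmetry.

Theorem theorem6p6 (R : realType) (mu : R -> probability R R) (gamma : R)
    (tau : {finite_measure set R -> \bar R}) :
  weakly_continuous mu ->
  monotone_semigroup mu ->
  (forall A : set R, measurable A -> mu 0 A = \d_(0 : R) A) ->
  associated_pair mu gamma tau ->
  (forall t : R, 0 <= t -> compact (msupport (mu t))) ->
  ((exists t0 : R, 0 < t0 /\ symmetric_measure (mu t0)) <->
     (forall t : R, 0 < t -> symmetric_measure (mu t))) /\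
  ((forall t : R, 0 < t -> symmetric_measure (mu t)) <->
     (gamma = 0 /\ symmetric_measure tau)).
Proof.
move=> _ semi _ pair csupp.
have fin t : (mu t setT < +oo)%E by rewrite probability_setT ltry.
(* A single symmetric time suffices here, so this covers (1) => (3), and its case t = 1 gives (2) =>
   (3). *)
have one_pair t : 0 < t -> symmetric_measure (mu t) -> gamma = 0 /\ symmetric_measure tau.
  move=> t0 symt; apply: equivariant_generatorA.
  apply: (equivariant_generator_of_dyadic pair t0) => n.
  apply: (dyadic_equivariant semi csupp) => //.
  exact: (cauchyH_equivariant (fin t) symt).
have pair_all : gamma = 0 /\ symmetric_measure tau ->
    forall t, 0 < t -> symmetric_measure (mu t).
  move=> [g0 symtau] t t0; apply: (symmetric_of_cauchyH (fin t)).
  exact: (semigroup_equivariant pair (generatorA_equivariant g0 symtau) (ltW t0)).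
split; split.
- by move=> [t [t0 symt]]; apply: pair_all; exact: one_pair symt.
- by move=> all; exists 1; split=> //; exact: all.
- by move=> all; apply: (one_pair 1) => //; exact: all.
- exact: pair_all.
Qed.
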